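(* Let $n_1\le n_2$ and let $f:\mathbb{R}^{n_1\times n_2}\to\mathbb{R}$ be a twice continuously differentiable convex function. Suppose that $\bar X$ is an optimal solution of the problem $\min_{X\in\mathbb{R}^{n_1\times n_2}} f(X)+\|X\|_*$, i.e., $\bar Y=-\nabla f(\bar X)\in\partial\|\bar X\|_*$. Let $p=p(\bar Y)$ be the number of singular values of $\bar Y$ equal to $1$, and let $(\bar U,\bar V)\in\mathcal{O}(\bar X)\cap\mathcal{O}(\bar Y)$ be from a simultaneous ordered singular value decomposition of $\bar X$ and $\bar Y$. Then $\bar X$ is a tilt-stable solution of this problem if and only if $$\mathrm{Ker}\,\nabla^2 f(\bar X)\cap\bar U\begin{pmatrix}\mathbb{S}^p&0\\0&0\end{pmatrix}\bar V^T=\{0\}.$$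
   Context: $\|X\|_*$ is the nuclear norm (sum of the singular values of $X$); $\partial$ is the convex subdifferential. Singular values are listed in nonincreasing order $\sigma_1(X)\ge\dots\ge\sigma_{n_1}(X)$. For $X\in\mathbb{R}^{n_1\times n_2}$, $\mathcal{O}(X)$ is the set of all pairs $(U,V)$ of orthogonal matrices $U\in\mathbb{R}^{n_1\times n_1}$, $V\in\mathbb{R}^{n_2\times n_2}$ with $X=U\begin{pmatrix}\Sigma&0\\0&0\end{pmatrix}_{n_1\times n_2}V^T$, where $\Sigma$ is the diagonal matrix of the positive singular values of $X$ in nonincreasing order. $p(Y)=\#\{i\in\{1,\dots,n_1\}:\sigma_i(Y)=1\}$. If $\bar Y\in\partial\|\bar X\|_*$, then $\mathcal{O}(\bar X)\cap\mathcal{O}(\bar Y)\neq\emptyset$, and for $(\bar U,\bar V)$ in it $\bar X=\bar U\begin{pmatrix}\Sigma&0\\0&0\end{pmatrix}\bar V^T$, $\bar Y=\bar U\begin{pmatrix}I_p&0&0\\0&\Lambda&0\end{pmatrix}\bar V^T$ with $\Lambda\in\mathbb{R}^{(n_1-p)\times(n_1-p)}$ diagonal containing the singular values of $\bar Y$ in $[0,1)$ (simultaneous ordered singular value decomposition). $\mathbb{S}^p$ is the space of $p\times p$ symmetric matrices, and $\bar U\begin{pmatrix}\mathbb{S}^p&0\\0&0\end{pmatrix}\bar V^T=\left\{\bar U\begin{pmatrix}A&0\\0&0\end{pmatrix}_{n_1\times n_2}\bar V^T: A\in\mathbb{S}^p\right\}$. $\mathrm{Ker}\,\nabla^2 f(\bar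 X)$ is the kernel of the Hessian viewed as a linear operator on $\mathbb{R}^{n_1\times n_2}$. Tilt stability: $\bar X$ is a tilt-stable solution of $\min\varphi$ if there is $\gamma>0$ such that the mapping $M_\gamma(V)=\mathrm{argmin}\{\varphi(X)-\langle V,X\rangle: X\in\mathbb{B}_\gamma(\bar X)\}$ is single-valued and Lipschitz continuous on some neighborhood of $0$ with $M_\gamma(0)=\bar X$, where $\mathbb{B}_\gamma(\bar X)$ is the open ball of radius $\gamma$ around $\bar X$. *)

(* Defs.v *)
From HB Require Import structures.
From mathcomp Require Import all_boot all_order all_algebra.
From mathcomp Require Import all_classical all_reals all_analysis.
From mathcomp Require Import complex.

Set Implicit Arguments.
Unset Strict Implicit.
Unset Printing Implicit Defensive.

Import Order.TTheory GRing.Theory Num.Theory.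
Import numFieldNormedType.Exports.

Local Open Scope classical_set_scope.
Local Open Scope ring_scope.

Section SingularValues.
Context {R : realType} {m n : nat}.
Implicit Types (X Y : 'M[R]_(m, n)) (s : 'rV[R]_m).

(* The singular values of an m x n matrix X with m <= n are the square roots
   of the m eigenvalues of X X^T, repeated according to multiplicity. *)
Definition is_sing_vals X s : Prop :=
  [/\ forall i, 0 <= s 0 i,
      forall i j : 'I_m, (i <= j)%N -> s 0 j <= s 0 i
    & char_poly (X *m X^T) = \prod_i ('X - (s 0 i ^+ 2)%:P)].

Definition sing_vals X : 'rV[R]_m := get (is_sing_vals X).

Lemma is_sing_vals_inj X s t : is_sing_vals X s -> is_sing_vals X t -> s = t.
Proof.
move=> [s0 sd sE] [t0 td tE].
pose l (u : 'rV[R]_m) := [seq u 0 i | i <- enum 'I_m].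
have lsort (u : 'rV[R]_m) : (forall i j : 'I_m, (i <= j)%N -> u 0 j <= u 0 i) ->
    sorted >=%R (l u).
  move=> ud; rewrite sorted_map.
  have : sorted ltn [seq val i | i <- enum 'I_m].
    by rewrite val_enum_ord iota_ltn_sorted.
  by rewrite sorted_map; apply: sub_sorted => i j /= /ltnW; exact: ud.
have lE (u : 'rV[R]_m) : \prod_(a <- [seq a ^+ 2 | a <- l u]) ('X - a%:P) =
    \prod_i ('X - (u 0 i ^+ 2)%:P).
  by rewrite 2!big_map big_enum.
have := esym sE; rewrite tE -!lE.
move=> /prod_XsubC_eq st.
have sqK (u : 'rV[R]_m) : (forall i, 0 <= u 0 i) ->
    [seq Num.sqrt a | a <- [seq a ^+ 2 | a <- l u]] = l u.
  move=> u0; rewrite -map_comp -[RHS]map_id; apply/eq_in_map => _ /mapP[i _ ->].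
  by rewrite /= sqrtr_sqr ger0_norm.
have {}st : perm_eq (l s) (l t) by rewrite -(sqK s)// -(sqK t)// perm_map.
have lst : l s = l t.
  apply: (sorted_eq _ _ (lsort _ sd) (lsort _ td) st).
  - by move=> a b c ba cb; exact: le_trans cb ba.
  - by move=> a b; rewrite andbC; exact: le_anti.
apply/rowP => i; move/eq_in_map: lst; apply; exact: mem_enum.
Qed.

Lemma is_sing_vals_exists X : exists s, is_sing_vals X s.
Proof.
pose C : numClosedFieldType := complex R.
pose c : {rmorphism R -> C} := real_complex R.
pose Xc : 'M[C]_(m, n) := map_mx c X.
pose A := X *m X^T; pose Ac : 'M[C]_m := map_mx c A.
have cR (a : R) : Num.conj (c a) = c a.
  by apply: conj_Creal; rewrite complex_real.
have AcE : Ac = Xc *m (map_mx Num.conj Xc^T).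
  rewrite /Ac map_mxM; congr (_ *m _).
  by apply/matrixP => i j; rewrite !mxE cR.
have AcN : Ac \is normalmx.
  apply/normalmxP; have -> // : map_mx Num.conj Ac^T = Ac.
  rewrite AcE trmx_mul map_mxM; congr (_ *m _).
    by apply/matrixP => i j; rewrite !mxE; exact: conjCK.
pose P := spectralmx Ac; pose d := spectral_diag Ac.
have dE : Ac = invmx P *m diag_mx d *m P by exact/orthomx_spectralP.
have PU : P \is unitarymx by exact: spectral_unitarymx.
have Pu : P \in unitmx by exact: spectral_unit.
have d0 i : 0 <= d 0 i.
  pose B := P *m Xc.
  have : diag_mx d = B *m map_mx Num.conj B^T.
    have : P *m Ac *m invmx P = diag_mx d.
      by rewrite dE !mulmxA mulmxV// mul1mx mulmxK.
    move=> <-; rewrite AcE (invmx_unitary PU) /B trmx_mul map_mxM.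
    by rewrite !mulmxA.
  move=> /matrixP/(_ i i); rewrite !mxE eqxx mulr1n => ->.
  by apply: sumr_ge0 => k _; rewrite !mxE mul_conjC_ge0.
have dR i : d 0 i = c (complex.Re (d 0 i)).
  by apply/esym/RRe_real; rewrite ger0_real.
pose e i := complex.Re (d 0 i).
have e0 i : 0 <= e i by have := d0 i; rewrite dR lecR.
have Ae : char_poly A = \prod_i ('X - (e i)%:P).
  apply: (@map_poly_inj _ _ c).
  rewrite map_char_poly -/Ac rmorph_prod/=.
  have -> : char_poly Ac = char_poly (diag_mx d).
    rewrite /char_poly dE.
    have -> : char_poly_mx (invmx P *m diag_mx d *m P) =
        map_mx polyC (invmx P) *m char_poly_mx (diag_mx d) *m map_mx polyC P.
      rewrite /char_poly_mx mulmxBr mulmxBl -!map_mxM/= mul_mx_scalar -scalemxAl.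
      by rewrite -map_mxM mulVmx// map_mx1 scalemx1.
    rewrite !det_mulmx mulrAC -det_mulmx -map_mxM mulVmx//.
    by rewrite map_mx1 det1 mul1r.
  rewrite char_poly_trig ?diag_mx_is_trig//; apply: eq_bigr => i _.
  by rewrite rmorphB/= map_polyX map_polyC/= -dR !mxE eqxx mulr1n.
pose l := sort >=%R [seq Num.sqrt (e i) | i <- enum 'I_m].
have sl : size l = m by rewrite size_sort size_map size_enum_ord.
exists (\row_i l`_i); split.
- move=> i; rewrite mxE.
  have : l`_i \in l by rewrite mem_nth// sl.
  by rewrite mem_sort => /mapP[j _ ->]; exact: sqrtr_ge0.
- move=> i j ij; rewrite !mxE.
  apply: (@sorted_leq_nth _ >=%R) => //; rewrite ?inE ?sl//.
  + by move=> a b k ba cb; exact: le_trans cb ba.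
  + exact: lexx.
  + by apply: (@sort_sorted R >=%R) => a b; exact: le_total.
- rewrite Ae.
  transitivity (\prod_(a <- l) ('X - (a ^+ 2)%:P)).
    rewrite (perm_big _ (permEl (perm_sort _ _))) /= big_map big_enum/=.
    by apply: eq_bigr => i _; rewrite sqr_sqrtr.
  rewrite (big_nth 0) sl big_mkord.
  by apply: eq_bigr => i _; rewrite mxE.
Qed.

Lemma sing_valsP X : is_sing_vals X (sing_vals X).
Proof. by have [s sP] := is_sing_vals_exists X; exact: (getI sP). Qed.

Definition nuclear_norm X : R := \sum_i sing_vals X 0 i.

Definition num_unit_sing_vals X : nat := #|[set i | sing_vals X 0 i == 1]%SET|.

Definition rect_diag s : 'M[R]_(m, n) :=
  \matrix_(i, j) (s 0 i *+ (i == j :> nat)).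

(* Since the singular values are ordered, rect_diag (sing_vals X) is the
   diagonal block of the positive singular values, padded with zeros. *)
Definition ordered_svd X : set ('M[R]_m * 'M[R]_n) :=
  [set UV | [/\ UV.1^T *m UV.1 = 1%:M, UV.2^T *m UV.2 = 1%:M
    & X = UV.1 *m rect_diag (sing_vals X) *m UV.2^T]].

End SingularValues.

Section MatrixOptimization.
Context {R : realType} {m n : nat}.
Notation M := 'M[R]_(m, n).
Implicit Types (X Y : M) (f phi : M -> R).

Definition frob_dot X Y : R := \tr (X^T *m Y).

(* The library's norm on matrices is the entrywise maximum; it induces the same
   topology (hence the same derivatives), but not the same balls. *)
Definition frob_norm X : R := Num.sqrt (frob_dot X X).

Definition frob_ball X (r : R) : set M := [set Y | frob_norm (Y - X) < r].

Definition is_global_min phi X : Prop := forall Z, phi X <= phi Z.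

Definition subdiff phi X : set M :=
  [set Y | forall Z, phi X + frob_dot Y (Z - X) <= phi Z].

(* The representative of the differential of f at X for frob_dot. *)
Definition gradient f X : M :=
  \matrix_(i, j) 'd (f : M -> R^o) X (delta_mx i j).

Definition hessian f X : {linear M -> M} := 'd (gradient f) X.

Definition twice_continuously_differentiable f : Prop :=
  [/\ forall X, differentiable (f : M -> R^o) X,
      forall X, differentiable (gradient f) X
    & forall H, continuous (fun X => hessian f X H)].

Definition hessian_ker f X : set M := [set H | hessian f X H = 0].

Definition argmin_on phi (B : set M) : set M :=
  [set X | B X /\ forall Z, B Z -> phi X <= phi Z].

Definition tilt_argmin phi X (gamma : R) (V : M) : set M :=
  argmin_on (fun Z => phi Z - frob_dot V Z) (frob_ball X gamma).

Definition tilt_stable phi X : Prop :=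
  exists gamma : R, 0 < gamma /\
  exists (N : set M) (g : M -> M) (L : R),
    [/\ nbhs (0 : M) N,
        forall V, N V -> tilt_argmin phi X gamma V = [set g V],
        forall V W, N V -> N W ->
          frob_norm (g V - g W) <= L * frob_norm (V - W)
      & g 0 = X].

(* pid_mx p *m A *m pid_mx p is the m x n matrix with A as its upper left block
   and zeros elsewhere when p <= m and p <= n. *)
Definition sym_block_space (p : nat) (U : 'M[R]_m) (V : 'M[R]_n) : set M :=
  [set U *m (pid_mx p *m A *m pid_mx p) *m V^T
     | A in [set A : 'M[R]_p | A^T = A]].

End MatrixOptimization.

(* Main.v *)
From HB Require Import structures.
Require Import Defs.
From mathcomp Require Import all_boot all_order all_algebra.
From mathcomp Require Import all_classical all_reals all_analysis.
From mathcomp Require Import ring lra.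

Import Order.TTheory GRing.Theory Num.Theory.
Import numFieldNormedType.Exports.

Local Open Scope classical_set_scope.
Local Open Scope ring_scope.

Set Implicit Arguments.
Unset Strict Implicit.
Unset Printing Implicit Defensive.

(** The nuclear norm is the support function of the set of contractions [Y]
    (matrices of spectral norm at most one), and [Y] is a subgradient at [X]
    exactly when [Y] is a contraction and the gap
    [defect Y X = nuclear_norm X - <Y, X>] vanishes.  The whole second-order
    analysis rests on one quantitative form of this fact.  If
    [X = sum_i d_i u_i v_i^T] is a singular value decomposition, then
    [defect Y X = sum_i d_i (1 - <u_i, Y v_i>)], and for unit vectors
    [|u - Y v|^2 <= 2 (1 - <u, Y v>)]; hence [X] is close to [Y Y^T X] and
    [Y^T X] is close to a symmetric matrix, both errors being of order
    [sqrt (|X| * defect Y X)] (polar_res_defect, skew_res_defect).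

    The two error terms vanish on [H] exactly when [H = Y S] with [S] symmetric
    and supported on the right singular vectors of [Y] for the singular value
    one (sym_block_of_residuals); for the given [Yb] this is the block space of
    the theorem.  As both are linear in [H] and vanish at a point [W] with
    [defect Y W = 0], the same bound holds for the increment [Z - W] in terms of
    [defect Y Z].

    Sufficiency.  The Hessian at [Xb] is positive semidefinite, and by convexity
    its isotropic vectors lie in its kernel (hessian_ker_of_dot0).  Under the
    kernel condition the quadratic form
    [<H, Hess H> + |polar_res Yb H|^2 + |skew_res Yb H|^2] is therefore positive
    definite, hence bounded below by a multiple of [|H|^2] (coercive), and this
    survives small perturbations of the base point and of the subgradient.  So
    every slightly tilted objective grows quadratically around its own
    minimizer, at a uniform rate and on a common ball (uniform_growth).  Adding
    two such inequalities gives uniqueness and Lipschitz dependence on the tilt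
    (tilt_stable_of_growth).

    Necessity.  Let [P], [Q] be the singular vectors of [Yb] for the singular
    value one, and let [H = P A Q^T] be in the kernel of the Hessian.  On the
    cone of all [P B Q^T] with [B] positive semidefinite, the nuclear norm is the
    linear form given by [Yb], so that every point [Z] of this cone minimizes the
    objective tilted by [gradient f Z + Yb].  The point [Xb + e P Q^T] is in the
    relative interior of that cone and may be moved along [H], even though [A]
    is indefinite.  Lipschitz dependence on the tilt then bounds [|H|] by a
    multiple of [|Hess H|] at points arbitrarily close to [Xb], so [H = 0]
    (tilt_stable_kernel). *)

(** * The Frobenius inner product *)

Section FrobeniusProduct.
Context {R : realType} {m n : nat}.
Implicit Types X Y Z : 'M[R]_(m, n).

Lemma frob_dotE X Y : frob_dot X Y = \sum_i \sum_j X i j * Y i j.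
Proof.
rewrite /frob_dot /mxtrace exchange_big /=; apply: eq_bigr => j _.
by rewrite mxE; apply: eq_bigr => i _; rewrite mxE.
Qed.

Lemma frob_dotC X Y : frob_dot X Y = frob_dot Y X.
Proof. by rewrite /frob_dot -mxtrace_tr trmx_mul trmxK. Qed.

Lemma frob_dotDr X Y Z : frob_dot X (Y + Z) = frob_dot X Y + frob_dot X Z.
Proof. by rewrite /frob_dot mulmxDr mxtraceD. Qed.

Lemma frob_dotZr X a Y : frob_dot X (a *: Y) = a * frob_dot X Y.
Proof. by rewrite /frob_dot -scalemxAr mxtraceZ. Qed.

Lemma frob_dotNr X Y : frob_dot X (- Y) = - frob_dot X Y.
Proof. by rewrite -scaleN1r frob_dotZr mulN1r. Qed.

Lemma frob_dotBr X Y Z : frob_dot X (Y - Z) = frob_dot X Y - frob_dot X Z.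
Proof. by rewrite frob_dotDr frob_dotNr. Qed.

Lemma frob_dot0r X : frob_dot X 0 = 0.
Proof. by rewrite /frob_dot mulmx0 mxtrace0. Qed.

Lemma frob_dotDl X Y Z : frob_dot (Y + Z) X = frob_dot Y X + frob_dot Z X.
Proof. by rewrite ![frob_dot _ X]frob_dotC frob_dotDr. Qed.

Lemma frob_dotZl X a Y : frob_dot (a *: Y) X = a * frob_dot Y X.
Proof. by rewrite ![frob_dot _ X]frob_dotC frob_dotZr. Qed.

Lemma frob_dotNl X Y : frob_dot (- Y) X = - frob_dot Y X.
Proof. by rewrite ![frob_dot _ X]frob_dotC frob_dotNr. Qed.

Lemma frob_dotBl X Y Z : frob_dot (Y - Z) X = frob_dot Y X - frob_dot Z X.
Proof. by rewrite ![frob_dot _ X]frob_dotC frob_dotBr. Qed.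

Lemma frob_dot0l X : frob_dot 0 X = 0.
Proof. by rewrite frob_dotC frob_dot0r. Qed.

Lemma frob_dot_ge0 X : 0 <= frob_dot X X.
Proof.
rewrite frob_dotE; apply: sumr_ge0 => i _; apply: sumr_ge0 => j _.
by rewrite -expr2 sqr_ge0.
Qed.

Lemma frob_normE X : frob_norm X ^+ 2 = frob_dot X X.
Proof. by rewrite /frob_norm sqr_sqrtr// frob_dot_ge0. Qed.

Lemma frob_norm_ge0 X : 0 <= frob_norm X.
Proof. exact: sqrtr_ge0. Qed.

Lemma frob_norm_entry X i j : `|X i j| <= frob_norm X.
Proof.
rewrite -sqrtr_sqr ler_wsqrtr// frob_dotE (bigD1 i)//= (bigD1 j)//= -expr2.
rewrite -addrA lerDl addr_ge0// ?sumr_ge0// => k _; rewrite ?sumr_ge0// => *.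
  by rewrite -expr2 sqr_ge0.
by rewrite -expr2 sqr_ge0.
Qed.

Lemma frob_norm_eq0 X : frob_norm X = 0 -> X = 0.
Proof.
move=> X0; apply/matrixP => i j; rewrite mxE; apply/eqP.
by rewrite -normr_le0 -X0 frob_norm_entry.
Qed.

Lemma frob_norm0 : frob_norm (0 : 'M[R]_(m, n)) = 0.
Proof. by rewrite /frob_norm frob_dot0r sqrtr0. Qed.

Lemma frob_norm_gt0 X : X != 0 -> 0 < frob_norm X.
Proof.
move=> X0; rewrite lt_def frob_norm_ge0 andbT; apply: contra X0.
by move=> /eqP/frob_norm_eq0 ->.
Qed.

Lemma frob_dot_eq0 X : frob_dot X X = 0 -> X = 0.
Proof. by move=> X0; apply: frob_norm_eq0; rewrite /frob_norm X0 sqrtr0. Qed.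

Lemma frob_normZ a X : frob_norm (a *: X) = `|a| * frob_norm X.
Proof.
rewrite /frob_norm frob_dotZl frob_dotZr mulrA -expr2 sqrtrM ?sqr_ge0//.
by rewrite sqrtr_sqr.
Qed.

Lemma frob_normN X : frob_norm (- X) = frob_norm X.
Proof. by rewrite -scaleN1r frob_normZ normrN1 mul1r. Qed.

Lemma frob_distC X Y : frob_norm (X - Y) = frob_norm (Y - X).
Proof. by rewrite -frob_normN opprB. Qed.

Lemma frob_CS X Y : frob_dot X Y <= frob_norm X * frob_norm Y.
Proof.
have [->|X0] := eqVneq X 0; first by rewrite frob_dot0l frob_norm0 mul0r.
have [->|Y0] := eqVneq Y 0; first by rewrite frob_dot0r frob_norm0 mulr0.
have a0 := frob_norm_gt0 X0; have b0 := frob_norm_gt0 Y0.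
have := frob_dot_ge0 (frob_norm Y *: X - frob_norm X *: Y).
rewrite frob_dotBl !frob_dotBr !frob_dotZl !frob_dotZr -!frob_normE.
rewrite (frob_dotC Y X).
move: (frob_norm X) (frob_norm Y) (frob_dot X Y) a0 b0 => a b c a0 b0 h.
have ab : 0 < a * b by rewrite mulr_gt0.
rewrite -(ler_pM2l ab); nra.
Qed.

Lemma frob_CS_abs X Y : `|frob_dot X Y| <= frob_norm X * frob_norm Y.
Proof.
rewrite ler_norml frob_CS andbT lerNl -frob_dotNl.
by rewrite (le_trans (frob_CS _ _))// frob_normN.
Qed.

Lemma frob_normD X Y : frob_norm (X + Y) <= frob_norm X + frob_norm Y.
Proof.
rewrite -ler_sqr ?nnegrE ?addr_ge0 ?frob_norm_ge0//.
rewrite frob_normE frob_dotDl !frob_dotDr -!frob_normE (frob_dotC Y X).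
have := frob_CS X Y; nra.
Qed.

Lemma frob_norm_tri X Y Z :
  frob_norm (X - Z) <= frob_norm (X - Y) + frob_norm (Y - Z).
Proof.
have -> : X - Z = (X - Y) + (Y - Z) by rewrite addrA subrK.
exact: frob_normD.
 Qed.

Lemma frob_dot_delta X i j : frob_dot X (delta_mx i j) = X i j.
Proof.
rewrite frob_dotE (bigD1 i)//= (bigD1 j)//= big1 => [|k kj].
  rewrite big1 ?addr0 ?mxE ?eqxx ?mulr1// => k ki.
  by apply: big1 => l _; rewrite mxE (negPf ki) mulr0.
by rewrite mxE (negPf kj) andbF mulr0.
Qed.

Lemma frob_norm_le_mx_norm X : frob_norm X <= (m * n)%:R * `|X|.
Proof.
have XE i j : `|X i j| <= `|X|.
  rewrite [leRHS]/Num.norm /= mx_normrE.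
  by apply/bigmax_geP; right; exists (i, j).
have N0 : (0 : R) <= `|X| by exact: normr_ge0.
rewrite -ler_sqr ?nnegrE ?frob_norm_ge0 ?mulr_ge0//.
rewrite frob_normE frob_dotE.
apply: (@le_trans _ _ ((m * n)%:R * `|X| ^+ 2)).
  rewrite natrM -mulrA.
  have -> : m%:R * (n%:R * `|X| ^+ 2) = \sum_(i < m) \sum_(j < n) (`|X| ^+ 2).
    by rewrite !sumr_const !card_ord -[in RHS]mulr_natl -[in RHS](mulr_natl _ n).
  apply: ler_sum => i _; apply: ler_sum => j _.
  by rewrite -expr2 -real_normK ?num_real// ler_sqr ?nnegrE.
rewrite exprMn ler_wpM2r ?sqr_ge0//.
by rewrite -natrX ler_nat; case: (m * n)%N => // k; rewrite leq_pmulr.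
Qed.

Lemma mx_norm_le_frob_norm X : `|X| <= frob_norm X.
Proof.
rewrite [leLHS]/Num.norm /= mx_normrE; apply/bigmax_leP; split.
  exact: frob_norm_ge0.
by move=> [i j] _; exact: frob_norm_entry.
Qed.

(** The topology is that of the maximum norm; it and the Frobenius norm bound
    each other up to the factor [m * n]. *)
Lemma nbhs_frobP X (A : set 'M[R]_(m, n)) :
  nbhs X A <-> exists2 r : R, 0 < r & frob_ball X r `<=` A.
Proof.
split=> [/nbhs_ballP[e /= e0 eA]|[r r0 rA]].
  exists e => // Y XY; apply: eA; rewrite mx_norm_ball /ball_/= distrC.
  exact: le_lt_trans (mx_norm_le_frob_norm _) _.
apply/nbhs_ballP; exists (r / (m * n).+1%:R); first exact: divr_gt0.
move=> Y; rewrite mx_norm_ball /ball_/= distrC => XY; apply: rA.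
apply: le_lt_trans (frob_norm_le_mx_norm _) _.
apply: (@le_lt_trans _ _ ((m * n).+1%:R * `|Y - X|)).
  by rewrite ler_wpM2r ?normr_ge0// ler_nat.
by rewrite mulrC -ltr_pdivlMr.
Qed.

Lemma frob_ball_center X (r : R) : 0 < r -> frob_ball X r X.
Proof. by move=> r0; rewrite /frob_ball/= subrr frob_norm0. Qed.

Lemma continuous_frobP (g : 'M[R]_(m, n) -> R) X :
  {for X, continuous g} -> forall e, 0 < e ->
  exists2 r : R, 0 < r & forall Y, frob_ball X r Y -> `|g Y - g X| < e.
Proof.
move=> gc e e0; move/cvgrPdist_lt: gc => /(_ e e0)/nbhs_frobP[r r0 rA].
by exists r => // Y /rA /=; rewrite distrC.
Qed.

Lemma continuous_frob_dot Y : continuous (frob_dot Y : 'M[R]_(m, n) -> R).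
Proof.
move=> X; apply/(@cvgrPdist_lt _ _ _ (nbhs X)) => e e0; apply/nbhs_frobP.
exists (e / (frob_norm Y + 1)).
  by rewrite divr_gt0// ltr_wpDl// frob_norm_ge0.
move=> Z /=; rewrite /frob_ball/= => XZ; rewrite -frob_dotBr.
apply: le_lt_trans (frob_CS_abs _ _) _; rewrite frob_distC.
apply: (@le_lt_trans _ _ ((frob_norm Y + 1) * frob_norm (Z - X))).
  by rewrite ler_wpM2r ?frob_norm_ge0// lerDl.
by rewrite mulrC -ltr_pdivlMr// ltr_wpDl// frob_norm_ge0.
Qed.

(** Bounded closed sets of row vectors are compact, and the homeomorphism
    [vec_mx] carries this over to matrices. *)
Lemma compact_frob_bounded (A : set 'M[R]_(m, n)) (r : R) :
  closed A -> (forall X, A X -> frob_norm X <= r) -> compact A.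
Proof.
move=> Ac Ab; pose h (x : 'rV[R]_(m * n)) : 'M[R]_(m, n) := vec_mx x.
have hle x y : `|h x - h y| <= `|x - y|.
  rewrite /h -linearB /= [leLHS]/Num.norm /= mx_normrE; apply/bigmax_leP.
  split=> // -[i j] _ /=; rewrite mxE [leRHS]/Num.norm /= mx_normrE.
  by apply/bigmax_geP; right; exists (0, mxvec_index i j).
have hc : continuous h.
  move=> x; apply/(@cvgrPdist_lt _ _ _ (nbhs x)) => e e0.
  apply/nbhs_ballP; exists e => // y; rewrite mx_norm_ball /ball_/= => xy.
  exact: le_lt_trans (hle _ _) xy.
have -> : A = h @` (h @^-1` A).
  apply/seteqP; split=> [X AX|_ [x + <-]//].
  by exists (mxvec X); rewrite /= /h mxvecK.
apply: continuous_compact; first exact: continuous_subspaceT.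
apply: bounded_closed_compact; last exact: preimage_closed.
exists r; split; first exact: num_real.
move=> s rs x /= /Ab hx; apply: le_trans (ltW rs); apply: le_trans hx.
rewrite [leLHS]/Num.norm /= mx_normrE; apply/bigmax_leP.
split=> [|[i j] _ /=]; first exact: frob_norm_ge0.
rewrite ord1 {i}; case/mxvec_indexP: j => i j.
by have := frob_norm_entry (h x) i j; rewrite /h mxE.
Qed.

End FrobeniusProduct.

(** * The spectral theorem for real symmetric matrices *)

Section Spectral.
Context {R : realType}.

(** If [s] is a singular value of [A], then [A^2 - s^2 = (A - s) (A + s)] is
    singular, so that [s] or [- s] is an eigenvalue of [A]. *)
Lemma sym_eigenvector n (A : 'M[R]_n.+1) : A^T = A ->
  exists a, exists2 v : 'rV[R]_n.+1, v *m A = a *: v & v != 0.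
Proof.
move=> Asym; have [_ _] := sing_valsP A; rewrite Asym.
set s := sing_vals A 0 0 => charE.
have : eigenvalue (A *m A) (s ^+ 2).
  rewrite eigenvalue_root_char charE rootE horner_prod.
  by rewrite (bigD1 ord0)//= !hornerE subrr mul0r.
move=> /eigenvalueP[v vE v0].
have [w0|w0] := eqVneq (v *m A + s *: v) 0.
  exists (- s); exists v => //.
  by rewrite scaleNr; apply/eqP; rewrite -addr_eq0 w0.
exists s; exists (v *m A + s *: v) => //.
by rewrite mulmxDl -mulmxA vE -scalemxAl scalerDr scalerA -expr2 addrC.
Qed.

Lemma row_mul_tr n (u v : 'rV[R]_n) : u *m v^T = (frob_dot u v)%:M.
Proof.
rewrite [LHS]mx11_scalar; congr (_%:M).
by rewrite frob_dotC /frob_dot mxtrace_mulC /mxtrace big_ord1.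
Qed.

(** The Householder reflection that exchanges the first basis vector and a
    given unit vector is an orthogonal matrix having the latter as a row. *)
Lemma orthogonal_with_row n (v : 'rV[R]_n.+1) : frob_dot v v = 1 ->
  exists2 Q : 'M[R]_n.+1, Q *m Q^T = 1%:M & row 0 Q = v.
Proof.
move=> v1; pose e : 'rV[R]_n.+1 := delta_mx 0 0.
have [->|ve] := eqVneq v e.
  by exists 1%:M; rewrite ?trmx1 ?mulmx1// row1.
have e1 : frob_dot e e = 1 by rewrite frob_dot_delta !mxE.
pose u := v - e; pose c := frob_dot u u.
have c0 : c != 0 by rewrite /c -frob_normE sqrf_eq0 gt_eqF// frob_norm_gt0// subr_eq0.
have eu : frob_dot e u = - (c / 2%:R).
  rewrite /c /u frob_dotBl !frob_dotBr v1 e1 (frob_dotC v e).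
  by field.
pose Q := 1%:M - (2%:R / c) *: (u^T *m u).
exists Q; last first.
  rewrite rowE mulmxBr mulmx1 -scalemxAr mulmxA row_mul_tr eu mul_scalar_mx.
  rewrite scalerA.
  have -> : 2%:R / c * - (c / 2%:R) = -1 by field.
  by rewrite scaleN1r opprK /u addrC subrK.
have QT : Q^T = Q.
  by rewrite /Q linearB /= trmx1 linearZ /= trmx_mul trmxK.
have PP : (u^T *m u) *m (u^T *m u) = c *: (u^T *m u).
  by rewrite mulmxA -(mulmxA u^T u) row_mul_tr mul_mx_scalar -scalemxAl.
rewrite QT /Q; move: (u^T *m u) PP => P PP.
rewrite mulmxBl mul1mx mulmxBr mulmx1 -!scalemxAl -!scalemxAr PP.
by apply/matrixP => i j; rewrite !mxE; field.
Qed.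

(** By induction: in an orthonormal basis that starts with a unit eigenvector,
    symmetry clears the first row and the first column off the diagonal. *)
Theorem sym_spectral n (A : 'M[R]_n) : A^T = A ->
  exists O : 'M[R]_n, exists2 d : 'rV[R]_n,
    O^T *m O = 1%:M & A = O *m diag_mx d *m O^T.
Proof.
elim: n A => [A _|n IHn A Asym].
  by exists 1%:M, 0; apply/matrixP => -[].
have [a [v0 v0A v00]] := sym_eigenvector Asym.
pose v := (frob_norm v0)^-1 *: v0.
have vA : v *m A = a *: v by rewrite -scalemxAl v0A scalerA mulrC -scalerA.
have v1 : frob_dot v v = 1.
  rewrite -frob_normE frob_normZ ger0_norm ?invr_ge0 ?frob_norm_ge0//.
  by rewrite mulVf ?expr1n// gt_eqF// frob_norm_gt0.
have [Q Q1 Qv] := orthogonal_with_row v1.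
have Q1' := mulmx1C Q1.
pose B : 'M[R]_(1 + n) := Q *m A *m Q^T.
have BT : B^T = B by rewrite /B !trmx_mul trmxK Asym mulmxA.
have B0 : row 0 B = a *: row 0 1%:M.
  by rewrite /B !row_mul Qv vA -scalemxAl -Qv -row_mul Q1.
have AE : A = Q^T *m B *m Q by rewrite /B !mulmxA Q1' mul1mx -mulmxA Q1' mulmx1.
clearbody B.
have B0j (j : 'I_(1 + n)) : B (lshift n 0) j = a *+ (j == lshift n 0).
  move/rowP: B0 => /(_ j); rewrite !mxE lshift0 => ->.
  by rewrite eq_sym mulr_natr.
have Bur : ursubmx B = 0.
  by apply/matrixP => i j; rewrite ord1 !mxE B0j eq_rlshift.
have Bdl : dlsubmx B = 0 by rewrite -[dlsubmx B]trmxK trmx_dlsub BT Bur trmx0.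
have Bul : ulsubmx B = a%:M.
  by apply/matrixP => i j; rewrite !ord1 !mxE B0j eqxx.
have BdT : (drsubmx B)^T = drsubmx B by rewrite trmx_drsub BT.
have [K [d' O1 dE]] := IHn _ BdT.
pose O : 'M[R]_(1 + n) := block_mx 1%:M 0 0 K.
have OT : O^T = block_mx 1%:M 0 0 K^T by rewrite tr_block_mx !trmx0 trmx1.
have OO : O^T *m O = 1%:M.
  rewrite OT /O mulmx_block !(mulmx0, mul0mx, addr0, add0r, mulmx1) O1.
  by rewrite -scalar_mx_block.
exists (Q^T *m O), (row_mx a%:M d').
  rewrite trmx_mul trmxK mulmxA -(mulmxA O^T) Q1 mulmx1.
  exact: OO.
have BE : B = O *m diag_mx (row_mx a%:M d') *m O^T.
  rewrite -[LHS]submxK Bur Bdl Bul dE OT /O diag_mx_row !mulmx_block.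
  rewrite !(mulmx0, mul0mx, addr0, add0r, mulmx1, mul1mx).
  by congr block_mx; apply/matrixP => i j; rewrite !ord1 !mxE eqxx.
by rewrite AE BE trmx_mul trmxK !mulmxA.
Qed.

End Spectral.

(** * Frobenius products and matrix multiplication *)

Section MoreFrobenius.
Context {R : realType}.

Lemma frob_dot_tr m n (X Y : 'M[R]_(m, n)) :
  frob_dot X^T Y^T = frob_dot X Y.
Proof. by rewrite /frob_dot trmxK -mxtrace_tr trmx_mul trmxK mxtrace_mulC. Qed.

Lemma frob_norm_tr m n (X : 'M[R]_(m, n)) : frob_norm X^T = frob_norm X.
Proof. by rewrite /frob_norm frob_dot_tr. Qed.

Lemma frob_dot_mulmxl m n k (A : 'M[R]_(k, m)) (X : 'M[R]_(m, n)) Y :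
  frob_dot (A *m X) Y = frob_dot X (A^T *m Y).
Proof. by rewrite /frob_dot trmx_mul mulmxA. Qed.

Lemma frob_dot_mulmxr m n k (A : 'M[R]_(n, k)) (X : 'M[R]_(m, n)) Y :
  frob_dot (X *m A) Y = frob_dot X (Y *m A^T).
Proof.
by rewrite /frob_dot trmx_mul -mulmxA mxtrace_mulC mulmxA.
Qed.

Lemma frob_dot_cols m n (X Y : 'M[R]_(m, n)) :
  frob_dot X Y = \sum_j frob_dot (col j X) (col j Y).
Proof.
rewrite frob_dotE exchange_big /=; apply: eq_bigr => j _.
by rewrite frob_dotE; apply: eq_bigr => i _; rewrite big_ord1 !mxE.
Qed.

Lemma col_mulmx m n k (A : 'M[R]_(m, n)) (B : 'M[R]_(n, k)) j :
  col j (A *m B) = A *m col j B.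
Proof. by rewrite !colE mulmxA. Qed.

Lemma col_mul_diag m n (A : 'M[R]_(m, n)) d j :
  col j (A *m diag_mx d) = d 0 j *: col j A.
Proof. by apply/matrixP => i k; rewrite mul_mx_diag !mxE mulrC. Qed.

Lemma frob_dot_diag m n k (Y : 'M[R]_(m, n)) (A : 'M[R]_(m, k)) d (B : 'M[R]_(n, k)) :
  frob_dot Y (A *m diag_mx d *m B^T) =
  \sum_i d 0 i * frob_dot (col i A) (Y *m col i B).
Proof.
rewrite frob_dotC frob_dot_mulmxr trmxK frob_dot_cols; apply: eq_bigr => i _.
by rewrite col_mul_diag frob_dotZl col_mulmx.
Qed.

Lemma frob_norm_sqr_diag m n k (A : 'M[R]_(m, k)) d (W : 'M[R]_(n, k)) :
  diag_mx d *m (W^T *m W) = diag_mx d ->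
  frob_norm (A *m diag_mx d *m W^T) ^+ 2 =
  \sum_i d 0 i ^+ 2 * frob_norm (col i A) ^+ 2.
Proof.
move=> dW; rewrite frob_normE frob_dot_mulmxr trmxK -!mulmxA dW frob_dot_cols.
apply: eq_bigr => i _; rewrite col_mul_diag frob_dotZl frob_dotZr frob_normE.
by rewrite mulrA -expr2.
Qed.

Lemma frob_norm_mulmx m n k (A : 'M[R]_(m, n)) (B : 'M[R]_(n, k)) :
  frob_norm (A *m B) <= frob_norm A * frob_norm B.
Proof.
rewrite -ler_sqr ?nnegrE ?mulr_ge0 ?frob_norm_ge0// exprMn !frob_normE.
rewrite -(frob_dot_tr A) (frob_dot_cols A^T) (frob_dot_cols B) mulr_suml.
rewrite frob_dotE; apply: ler_sum => i _.
rewrite mulr_sumr; apply: ler_sum => j _.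
have -> : (A *m B) i j = frob_dot (col i A^T) (col j B).
  rewrite mxE frob_dotE; apply: eq_bigr => l _.
  by rewrite big_ord1 !mxE.
rewrite -!frob_normE -expr2 -exprMn.
rewrite -real_normK ?num_real// ler_sqr ?nnegrE ?mulr_ge0 ?frob_norm_ge0//.
exact: frob_CS_abs.
Qed.

Lemma frob_norm_orthogonal m n (U : 'M[R]_(m, n)) k (X : 'M[R]_(n, k)) :
  U^T *m U = 1%:M -> frob_norm (U *m X) = frob_norm X.
Proof. by move=> U1; rewrite /frob_norm frob_dot_mulmxl mulmxA U1 mul1mx. Qed.

Lemma frob_norm_col_orthogonal m n (U : 'M[R]_(m, n)) i :
  U^T *m U = 1%:M -> frob_norm (col i U) = 1.
Proof.
move=> U1; rewrite colE frob_norm_orthogonal//.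
by rewrite /frob_norm frob_dot_delta mxE !eqxx sqrtr1.
Qed.

End MoreFrobenius.

(** * Contractions *)

Section Contraction.
Context {R : realType}.

(** Spectral norm at most one, without mention of singular values. *)
Definition contractive m n (Y : 'M[R]_(m, n)) :=
  forall v : 'cV[R]_n, frob_norm (Y *m v) <= frob_norm v.

Lemma contraction_mulmx m n k (Y : 'M[R]_(m, n)) (A : 'M[R]_(n, k)) :
  contractive Y -> frob_norm (Y *m A) <= frob_norm A.
Proof.
move=> Yc; rewrite -ler_sqr ?nnegrE ?frob_norm_ge0// !frob_normE.
rewrite (frob_dot_cols (Y *m A)) (frob_dot_cols A).
apply: ler_sum => j _; rewrite col_mulmx -!frob_normE.
by rewrite ler_sqr ?nnegrE ?frob_norm_ge0.
Qed.

Lemma contraction_tr m n (Y : 'M[R]_(m, n)) : contractive Y -> contractive Y^T.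
Proof.
move=> Yc v; have [->|v0] := eqVneq (Y^T *m v) 0.
  by rewrite frob_norm0 frob_norm_ge0.
have vn := frob_norm_gt0 v0.
rewrite -(ler_pM2l vn) -expr2 frob_normE frob_dot_mulmxl trmxK.
rewrite (le_trans (frob_CS _ _))// mulrC.
by rewrite ler_wpM2r ?frob_norm_ge0.
Qed.

Lemma contraction_comp m n k (Y : 'M[R]_(m, n)) (Z : 'M[R]_(n, k)) :
  contractive Y -> contractive Z -> contractive (Y *m Z).
Proof. by move=> Yc Zc v; rewrite -mulmxA (le_trans (Yc _)). Qed.

Lemma orthogonal_contraction m n (U : 'M[R]_(m, n)) :
  U^T *m U = 1%:M -> contractive U.
Proof. by move=> U1 v; rewrite frob_norm_orthogonal. Qed.

(** For vectors [u], [v] of norm at most one and a contraction [Y],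
    [|u - Y v|^2 <= 2 (1 - <u, Y v>)]; the inequality is the sum of these over
    the pairs of columns of [A] and [B], weighted by [d]. *)
Lemma contraction_defect m n k (Y : 'M[R]_(m, n)) (A : 'M[R]_(m, k))
    (B : 'M[R]_(n, k)) (d : 'rV_k) : contractive Y ->
  (forall i, 0 <= d 0 i) ->
  (forall i, frob_norm (col i A) <= 1) -> (forall i, frob_norm (col i B) <= 1) ->
  \sum_i d 0 i * frob_norm (col i (A - Y *m B)) ^+ 2 <=
  2 * (\sum_i d 0 i - frob_dot Y (A *m diag_mx d *m B^T)).
Proof.
move=> Yc d0 A1 B1; rewrite frob_dot_diag -sumrB mulr_sumr.
apply: ler_sum => i _.
rewrite (_ : 2 * _ = d 0 i * (2 * (1 - frob_dot (col i A) (Y *m col i B)))).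
  2: by ring.
rewrite ler_wpM2l// linearB /= col_mulmx.
have := Yc (col i B); have := A1 i; have := B1 i.
rewrite frob_normE frob_dotBl !frob_dotBr (frob_dotC (Y *m _) (col i A)).
move: (col i A) (col i B) => a b b1 a1 yb.
have aa : frob_dot a a <= 1 by rewrite -frob_normE expr_le1// frob_norm_ge0.
have bb : frob_dot (Y *m b) (Y *m b) <= 1.
  rewrite -frob_normE expr_le1// ?frob_norm_ge0//; exact: le_trans yb b1.
lra.
Qed.

End Contraction.

(** * The nuclear norm *)

Section NuclearNorm.
Context {R : realType} {m n : nat}.
Implicit Types X Y Z : 'M[R]_(m, n).

Lemma char_poly_orthogonal_diag (U : 'M[R]_m) d : U^T *m U = 1%:M ->
  char_poly (U *m diag_mx d *m U^T) = \prod_i ('X - (d 0 i)%:P).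
Proof.
move=> U1; have U1' := mulmx1C U1.
have -> : \prod_i ('X - (d 0 i)%:P) = char_poly (diag_mx d).
  rewrite char_poly_trig ?diag_mx_is_trig//; apply: eq_bigr => i _.
  by rewrite !mxE eqxx mulr1n.
rewrite /char_poly.
have -> : char_poly_mx (U *m diag_mx d *m U^T) =
    map_mx polyC U *m char_poly_mx (diag_mx d) *m map_mx polyC U^T.
  rewrite /char_poly_mx mulmxBr mulmxBl -!map_mxM/= mul_mx_scalar -scalemxAl.
  by rewrite -map_mxM U1' map_mx1 scalemx1.
rewrite !det_mulmx mulrAC -det_mulmx -map_mxM U1'.
by rewrite map_mx1 det1 mul1r.
Qed.

(** A singular value decomposition in which [W] is only a partial isometry: its
    columns for zero singular values vanish, so that no orthonormal family has
    to be completed.  The identity [diag_mx d *m (W^T *m W) = diag_mx d] is all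
    that is left of the orthonormality of the columns of [W]. *)
Lemma nuclear_normE X : exists U : 'M[R]_m, exists d : 'rV[R]_m,
  exists W : 'M[R]_(n, m),
  [/\ U^T *m U = 1%:M, forall i, 0 <= d 0 i, contractive W,
      diag_mx d *m (W^T *m W) = diag_mx d
    & X = U *m diag_mx d *m W^T] /\ nuclear_norm X = \sum_i d 0 i.
Proof.
have XXs : (X *m X^T)^T = X *m X^T by rewrite trmx_mul trmxK.
have [U [e U1 XE]] := sym_spectral XXs.
have U1' := mulmx1C U1.
have [Z ZX] : exists Z, Z = U^T *m X by eexists.
have ZE : Z *m Z^T = diag_mx e.
  rewrite ZX trmx_mul trmxK mulmxA -(mulmxA _ X) XE !mulmxA U1 mul1mx.
  by rewrite -mulmxA U1 mulmx1.
have eE i : e 0 i = \sum_j Z i j ^+ 2.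
  move/matrixP: ZE => /(_ i i); rewrite [RHS]mxE eqxx mulr1n => <-.
  by rewrite mxE; apply: eq_bigr => j _; rewrite mxE -expr2.
have e0 i : 0 <= e 0 i by rewrite eE sumr_ge0// => j _; rewrite sqr_ge0.
pose d : 'rV[R]_m := \row_i Num.sqrt (e 0 i).
(* As 0^-1 = 0, this is the pseudo-inverse of the diagonal of singular values. *)
pose c : 'rV[R]_m := \row_i (Num.sqrt (e 0 i))^-1.
have cde i : c 0 i * e 0 i * c 0 i = (d 0 i != 0)%:R.
  rewrite !mxE; move: (sqr_sqrtr (e0 i)); move: (Num.sqrt _) => s <-.
  by have [->|s0] := eqVneq s 0; [rewrite invr0 mulr0|rewrite /=; field].
have cZ : diag_mx d *m (diag_mx c *m Z) = Z.
  apply/matrixP => i j; rewrite !mul_diag_mx !mxE mulrA.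
  have [s0|s0] := eqVneq (Num.sqrt (e 0 i)) 0; last by rewrite mulfV ?mul1r.
  have : e 0 i == 0 by rewrite eq_le e0 andbT -sqrtr_eq0 s0.
  rewrite eE psumr_eq0 => [|k _]; last exact: sqr_ge0.
  move=> /allP/(_ j); rewrite mem_index_enum => /(_ isT).
  by rewrite sqrf_eq0 => /eqP ->; rewrite mulr0.
pose W := (diag_mx c *m Z)^T.
have WW : W^T *m W = diag_mx (\row_i (d 0 i != 0)%:R).
  rewrite /W trmxK trmx_mul tr_diag_mx mulmxA -(mulmxA _ Z) ZE.
  rewrite !mulmx_diag; congr diag_mx; apply/rowP => i.
  by rewrite [in RHS]mxE -cde !mxE.
exists U, d, W; split; first split => //.
- by move=> i; rewrite mxE sqrtr_ge0.
- move=> v; rewrite -ler_sqr ?nnegrE ?frob_norm_ge0// !frob_normE.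
  rewrite frob_dot_mulmxl mulmxA WW !frob_dotE; apply: ler_sum => i _.
  apply: ler_sum => j _; rewrite mul_diag_mx [in X in _ * X]mxE.
  rewrite [(\row_i _) _ _]mxE mulrCA; case: eqP => _; last by rewrite mul1r.
  by rewrite mul0r -expr2 sqr_ge0.
- rewrite WW mulmx_diag; congr diag_mx; apply/rowP => i; rewrite !mxE.
  by have [->|_] := eqVneq; rewrite ?mul0r ?mulr1.
- by rewrite /W trmxK -mulmxA cZ ZX mulmxA U1' mul1mx.
have [s0 _] := sing_valsP X.
rewrite XE char_poly_orthogonal_diag// => sE.
have : perm_eq [seq e 0 i | i <- enum 'I_m]
    [seq sing_vals X 0 i ^+ 2 | i <- enum 'I_m].
  by apply: prod_XsubC_eq; rewrite !big_map.
move=> /(perm_map (@Num.sqrt R)) /(perm_big _)/= E.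
rewrite /nuclear_norm; symmetry.
transitivity (\sum_(a <- [seq Num.sqrt i | i <- [seq e 0 i | i <- enum 'I_m]]) a).
  by rewrite !big_map; apply: eq_bigr => i _; rewrite mxE.
rewrite E !big_map; apply: eq_bigr => i _.
by rewrite sqrtr_sqr ger0_norm.
Qed.

Lemma nuclear_norm_contraction Y X :
  contractive Y -> frob_dot Y X <= nuclear_norm X.
Proof.
have [U [d [W [[U1 d0 Wc dW XE] nE]]]] := nuclear_normE X.
move=> Yc; rewrite nE {1}XE -subr_ge0 -(pmulr_rge0 _ (ltr0Sn R 1)).
apply: le_trans (contraction_defect Yc d0 _ _); first last.
- by move=> i; rewrite colE (le_trans (Wc _))// /frob_norm frob_dot_delta mxE !eqxx sqrtr1.
- by move=> i; rewrite frob_norm_col_orthogonal.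
by apply: sumr_ge0 => i _; rewrite mulr_ge0// sqr_ge0.
Qed.

(** The partial isometry [U *m W^T] is the maximizer; together with the previous
    bound, this makes the nuclear norm the support function of the contractions,
    from which convexity, homogeneity and Lipschitz continuity follow. *)
Lemma nuclear_norm_attained X :
  exists2 Q : 'M[R]_(m, n), contractive Q & nuclear_norm X = frob_dot Q X.
Proof.
have [U [d [W [[U1 d0 Wc dW XE] nE]]]] := nuclear_normE X.
exists (U *m W^T).
  apply: contraction_comp; first exact: orthogonal_contraction.
  exact: contraction_tr.
rewrite nE {1}XE /frob_dot trmx_mul trmxK mulmxA mulmxA -(mulmxA W) U1 mulmx1.
by rewrite mxtrace_mulC mulmxA mxtrace_mulC dW mxtrace_diag.
Qed.

Lemma nuclear_norm_conv X Z t : 0 <= t <= 1 ->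
  nuclear_norm (X + t *: (Z - X)) <= (1 - t) * nuclear_norm X + t * nuclear_norm Z.
Proof.
move=> /andP[t0 t1]; have [Q Qc ->] := nuclear_norm_attained (X + t *: (Z - X)).
have := nuclear_norm_contraction X Qc; have := nuclear_norm_contraction Z Qc.
rewrite frob_dotDr frob_dotZr frob_dotBr; nra.
Qed.

Lemma nuclear_norm0 : nuclear_norm (0 : 'M[R]_(m, n)) = 0.
Proof. by have [Q _ ->] := nuclear_norm_attained 0; rewrite frob_dot0r. Qed.

Lemma nuclear_normZ a X : 0 <= a -> nuclear_norm (a *: X) = a * nuclear_norm X.
Proof.
move=> a0; apply/eqP; rewrite eq_le; apply/andP; split.
  have [Q Qc ->] := nuclear_norm_attained (a *: X).
  by rewrite frob_dotZr ler_wpM2l// nuclear_norm_contraction.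
have [Q Qc ->] := nuclear_norm_attained X.
by rewrite -frob_dotZr nuclear_norm_contraction.
Qed.

Lemma nuclear_norm_lipschitz X Z :
  nuclear_norm X - nuclear_norm Z <= frob_norm (1%:M : 'M[R]_n) * frob_norm (X - Z).
Proof.
have [Q Qc ->] := nuclear_norm_attained X.
apply: (@le_trans _ _ (frob_dot Q (X - Z))).
  by rewrite frob_dotBr lerB// nuclear_norm_contraction.
rewrite (le_trans (frob_CS _ _))// ler_wpM2r ?frob_norm_ge0//.
by rewrite -[Q in leLHS]mulmx1 contraction_mulmx.
Qed.

End NuclearNorm.

(** * Subgradients of the nuclear norm *)

Section Defect.
Context {R : realType} {m n : nat}.
Implicit Types X Y Z H : 'M[R]_(m, n).

(** The gap in the inequality [<Y, X> <= nuclear_norm X]; it vanishes exactly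
    when the contraction [Y] is a subgradient at [X]. *)
Definition defect Y X : R := nuclear_norm X - frob_dot Y X.

Lemma defect_ge0 Y X : contractive Y -> 0 <= defect Y X.
Proof. by move=> Yc; rewrite subr_ge0 nuclear_norm_contraction. Qed.

(** The matrix [S] is the polar factor [(X^T X)^(1/2)].  A contraction with zero
    defect satisfies [X = Y S] and [Y^T X = S]; in general
    [X - Y S = (U - Y W) D W^T], whose norm is controlled by the defect column by
    column, each singular value being at most the norm of [X]. *)
Lemma defect_polar Y X : contractive Y -> exists2 S : 'M[R]_n, S^T = S &
  frob_norm (X - Y *m S) ^+ 2 <= 2 * frob_norm X * defect Y X /\
  frob_norm (Y^T *m X - S) ^+ 2 <= 2 * frob_norm X * defect Y X.
Proof.
move=> Yc; have [U [d [W [[U1 d0 Wc dW XE] nE]]]] := nuclear_normE X.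
have U1' := mulmx1C U1.
have colU i : frob_norm (col i U) = 1 by rewrite frob_norm_col_orthogonal.
have colW i : frob_norm (col i W) <= 1.
  by rewrite colE (le_trans (Wc _))// /frob_norm frob_dot_delta mxE !eqxx sqrtr1.
have dX i : d 0 i <= frob_norm X.
  rewrite -ler_sqr ?nnegrE ?frob_norm_ge0// XE frob_norm_sqr_diag//.
  rewrite (bigD1 i)//= colU expr1n mulr1 lerDl sumr_ge0// => j _.
  by rewrite mulr_ge0// sqr_ge0.
have key k (M : 'M[R]_(k, m)) :
    \sum_i d 0 i * frob_norm (col i M) ^+ 2 <= 2 * defect Y X ->
    frob_norm (M *m diag_mx d *m W^T) ^+ 2 <= 2 * frob_norm X * defect Y X.
  move=> h; rewrite frob_norm_sqr_diag// -mulrA mulrCA.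
  apply: le_trans (ler_wpM2l (frob_norm_ge0 _) h).
  rewrite mulr_sumr; apply: ler_sum => i _; rewrite expr2 -mulrA.
  by rewrite ler_wpM2r// mulr_ge0// sqr_ge0.
exists (W *m diag_mx d *m W^T).
  by rewrite !trmx_mul trmxK tr_diag_mx mulmxA.
split.
  have -> : X - Y *m (W *m diag_mx d *m W^T) =
      (U - Y *m W) *m diag_mx d *m W^T.
    by rewrite {1}XE !mulmxBl !mulmxA.
  apply: key; rewrite /defect nE [in frob_dot _ _]XE.
  by apply: contraction_defect => // i; rewrite colU.
have -> : Y^T *m X - W *m diag_mx d *m W^T =
    - ((W - Y^T *m U) *m diag_mx d *m W^T).
  by rewrite {1}XE !mulmxBl !mulmxA opprB.
rewrite frob_normN; apply: key; rewrite /defect nE.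
have -> : frob_dot Y X = frob_dot Y^T (W *m diag_mx d *m U^T).
  by rewrite -frob_dot_tr; congr frob_dot; rewrite XE !trmx_mul trmxK tr_diag_mx mulmxA.
apply: contraction_defect => //; first exact: contraction_tr.
by move=> i; rewrite colU.
Qed.

(** [polar_res] and [skew_res] measure how far [H] is from being [Y S] with [S]
    symmetric.  Unlike [S] in [defect_polar], they are linear in [H]. *)
Definition polar_res Y H := H - Y *m (Y^T *m H).
Definition skew_res Y H := Y^T *m H - H^T *m Y.

Lemma polar_res_defect Y X : contractive Y ->
  frob_norm (polar_res Y X) ^+ 2 <= 8 * frob_norm X * defect Y X.
Proof.
move=> Yc; have [S _ [h1 h2]] := defect_polar X Yc.
have h3 : frob_norm (polar_res Y X) <=
    frob_norm (X - Y *m S) + frob_norm (Y^T *m X - S).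
  have -> : polar_res Y X = (X - Y *m S) - Y *m (Y^T *m X - S).
    by rewrite /polar_res mulmxBr opprB addrA subrK.
  apply: le_trans (frob_normD _ _) _; rewrite frob_normN lerD2l.
  exact: contraction_mulmx.
have := frob_norm_ge0 (polar_res Y X).
have := frob_norm_ge0 (X - Y *m S); have := frob_norm_ge0 (Y^T *m X - S).
move: h1 h2 h3; move: (frob_norm (X - _)) (frob_norm (_ - S)) => a b.
move: (frob_norm (polar_res _ _)) (frob_norm X) (defect _ _) => c x e.
move=> a2 b2 cab b0 a0 c0.
have : c ^+ 2 <= (a + b) ^+ 2 by rewrite ler_sqr ?nnegrE ?addr_ge0.
have := sqr_ge0 (a - b); lra.
Qed.

Lemma skew_res_defect Y X : contractive Y ->
  frob_norm (skew_res Y X) ^+ 2 <= 8 * frob_norm X * defect Y X.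
Proof.
move=> Yc; have [S ST [_ h2]] := defect_polar X Yc.
have h3 : frob_norm (skew_res Y X) <= 2 * frob_norm (Y^T *m X - S).
  have -> : skew_res Y X = (Y^T *m X - S) - (Y^T *m X - S)^T.
    by rewrite linearB /= trmx_mul trmxK ST opprB addrA subrK.
  apply: le_trans (frob_normD _ _) _; rewrite frob_normN frob_norm_tr; lra.
have := frob_norm_ge0 (skew_res Y X); have := frob_norm_ge0 (Y^T *m X - S).
move: h2 h3; move: (frob_norm (_ - S)) (frob_norm (skew_res _ _)) => a c.
move=> a2 ca a0 c0.
have : c ^+ 2 <= (2 * a) ^+ 2 by rewrite ler_sqr ?nnegrE ?mulr_ge0.
lra.
Qed.

(** Testing the subgradient inequality at [0] and [2 X] gives a zero defect by
    homogeneity; testing it at the rank one matrices [(Y v) v^T], whose nuclear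
    norm is at most [|Y v| |v|], shows that [Y] is a contraction. *)
Lemma subdiff_nuclear_normP X Y :
  subdiff nuclear_norm X Y <-> contractive Y /\ defect Y X = 0.
Proof.
split=> [sY|[Yc /eqP]]; last first.
  rewrite subr_eq0 => /eqP XY Z; rewrite frob_dotBr XY addrC subrK.
  exact: nuclear_norm_contraction.
have XY : nuclear_norm X = frob_dot Y X.
  have := sY 0; have := sY (2 *: X).
  rewrite !frob_dotBr frob_dot0r frob_dotZr nuclear_norm0 nuclear_normZ//; lra.
split; last by rewrite /defect XY subrr.
have le_nuc Z : frob_dot Y Z <= nuclear_norm Z.
  by have := sY Z; rewrite XY frob_dotBr addrC subrK.
move=> v; have [->|Yv0] := eqVneq (Y *m v) 0.
  by rewrite frob_norm0 frob_norm_ge0.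
have dE (Z : 'M[R]_(m, n)) a : frob_dot Z (a *m v^T) = frob_dot (Z *m v) a.
  by rewrite frob_dot_mulmxr.
have := le_nuc (Y *m v *m v^T).
have [Q Qc ->] := nuclear_norm_attained (Y *m v *m v^T).
rewrite !dE -frob_normE => /le_trans/(_ (frob_CS _ _)) h.
rewrite -(ler_pM2r (frob_norm_gt0 Yv0)) -expr2 (le_trans h)//.
by rewrite ler_wpM2r// frob_norm_ge0.
Qed.

(** Diagonalizing [B] writes the matrix as a combination, with nonnegative
    coefficients, of rank one matrices [a b^T] with [a] and [b] of norm one. *)
Lemma nuclear_norm_psd p (P : 'M[R]_(m, p)) (Q : 'M[R]_(n, p)) (B : 'M[R]_p) :
  P^T *m P = 1%:M -> Q^T *m Q = 1%:M ->
  B^T = B -> (forall v : 'cV[R]_p, 0 <= frob_dot v (B *m v)) ->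
  nuclear_norm (P *m B *m Q^T) <= \tr B.
Proof.
move=> P1 Q1 BT B0; have [Z Zc ->] := nuclear_norm_attained (P *m B *m Q^T).
have [K [b O1 BE]] := sym_spectral BT.
have b0 i : 0 <= b 0 i.
  have := B0 (col i K).
  rewrite frob_dotC BE -!mulmxA frob_dot_mulmxl -[K^T *m col i K]col_mulmx O1.
  rewrite colE mul1mx frob_dot_delta mul_diag_mx !mxE !eqxx.
  by rewrite mulr1.
have -> : \tr B = \sum_i b 0 i.
  by rewrite BE mxtrace_mulC mulmxA O1 mul1mx mxtrace_diag.
have -> : P *m B *m Q^T = (P *m K) *m diag_mx b *m (Q *m K)^T.
  by rewrite BE trmx_mul !mulmxA.
have orth k (T : 'M[R]_(k, p)) i : T^T *m T = 1%:M ->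
    frob_norm (col i (T *m K)) <= 1.
  by move=> T1; rewrite col_mulmx frob_norm_orthogonal// frob_norm_col_orthogonal.
rewrite -subr_ge0 -(pmulr_rge0 _ (ltr0Sn R 1)).
apply: le_trans (contraction_defect Zc b0 _ _).
- by apply: sumr_ge0 => i _; rewrite mulr_ge0// sqr_ge0.
- by move=> i; exact: orth.
- by move=> i; exact: orth.
Qed.

End Defect.

(** * Singular vectors for the singular value one *)

Section Frame.
Context {R : realType} {m n : nat}.

Lemma card_ord_lt k : (k <= m)%N -> #|[set i : 'I_m | (i < k)%N]%SET| = k.
Proof.
move=> km; rewrite -sum1_card; under eq_bigl do rewrite inE.
by rewrite -(big_ord_widen m (fun=> 1%N)) // sum1_card card_ord.
Qed.

Lemma initial_segment (S : {set 'I_m}) :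
  (forall i j : 'I_m, (i <= j)%N -> j \in S -> i \in S) ->
  forall i : 'I_m, (i \in S) = (i < #|S|)%N.
Proof.
move=> Sd i; apply/idP/idP => [iS|].
  rewrite -[X in (X <= _)%N](card_ord_lt (ltn_ord i)).
  apply: subset_leq_card; apply/fintype.subsetP => j; rewrite inE ltnS => ji; exact: Sd iS.
apply: contraLR => iS; rewrite -leqNgt -[X in (_ <= X)%N](card_ord_lt (ltnW (ltn_ord i))).
apply: subset_leq_card; apply/fintype.subsetP => j jS; rewrite inE ltnNge.
by apply: contra iS => ij; exact: Sd jS.
Qed.

Variable hmn : (m <= n)%N.
Implicit Types s t : 'rV[R]_m.

Lemma rect_diagE s : rect_diag s = diag_mx s *m (pid_mx m : 'M[R]_(m, n)).
Proof.
by apply/matrixP => i j; rewrite mul_diag_mx !mxE ltn_ord andbT mulr_natr.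
Qed.

Lemma pid_mx_orth : (pid_mx m : 'M[R]_(m, n)) *m (pid_mx m : 'M[R]_(m, n))^T = 1%:M.
Proof. by rewrite tr_pid_mx mul_pid_mx minnn (minn_idPr hmn) pid_mx_1. Qed.

Lemma frob_dot_rect_diag s t :
  frob_dot (rect_diag s : 'M[R]_(m, n)) (rect_diag t) = \sum_i s 0 i * t 0 i.
Proof.
rewrite !rect_diagE frob_dot_mulmxr -mulmxA pid_mx_orth mulmx1 /frob_dot.
by rewrite tr_diag_mx mulmx_diag mxtrace_diag; apply: eq_bigr => i _; rewrite mxE.
Qed.

Variables (U : 'M[R]_m) (V : 'M[R]_n).
Hypotheses (U1 : U^T *m U = 1%:M) (V1 : V^T *m V = 1%:M).

Lemma frob_dot_svd s t :
  frob_dot (U *m rect_diag s *m V^T) (U *m rect_diag t *m V^T) =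
  \sum_i s 0 i * t 0 i.
Proof.
rewrite frob_dot_mulmxr trmxK -(mulmxA _ _ V) V1 mulmx1 frob_dot_mulmxl mulmxA.
by rewrite U1 mul1mx frob_dot_rect_diag.
Qed.

Variables (X Y : 'M[R]_(m, n)).
Hypotheses (YE : Y = U *m rect_diag (sing_vals Y) *m V^T)
  (XE : X = U *m rect_diag (sing_vals X) *m V^T)
  (Yc : contractive Y) (XY : defect Y X = 0).

Let p := num_unit_sing_vals Y.

Lemma sing_vals_le1 i : sing_vals Y 0 i <= 1.
Proof.
have h : frob_norm (Y^T *m col i U) <= 1.
  by rewrite -(frob_norm_col_orthogonal i U1) contraction_tr.
apply: le_trans h; rewrite {2}YE !trmx_mul trmxK -!mulmxA -col_mulmx U1.
rewrite frob_norm_orthogonal// -col_mulmx mulmx1.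
have := frob_norm_entry (col i (rect_diag (sing_vals Y) : 'M[R]_(m, n))^T)
  (widen_ord hmn i) 0.
by rewrite !mxE eqxx mulr1n; exact/le_trans/ler_norm.
Qed.

Lemma unit_sing_vals (i : 'I_m) : (sing_vals Y 0 i == 1) = (i < p)%N.
Proof.
have [s0 sd _] := sing_valsP Y.
have := @initial_segment [set i | sing_vals Y 0 i == 1]%SET _ i.
rewrite inE; apply => k l kl; rewrite !inE => /eqP l1.
by rewrite eq_le sing_vals_le1 -l1 sd.
Qed.

(** Since [<Y, X>] is the sum of the products of the singular values, a zero
    defect leaves no singular value of [X] against one of [Y] below one. *)
Lemma sing_vals_supp (i : 'I_m) : (p <= i)%N -> sing_vals X 0 i = 0.
Proof.
move=> pi; have [s0 _ _] := sing_valsP X.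
have dE : frob_dot Y X = \sum_i sing_vals Y 0 i * sing_vals X 0 i.
  by rewrite {1}YE {1}XE frob_dot_svd.
move: XY; rewrite /defect /nuclear_norm dE -sumrB => /eqP.
rewrite psumr_eq0 => [|k _].
  move=> /allP/(_ i); rewrite mem_index_enum => /(_ isT)/=.
  rewrite -{1}[sing_vals X 0 i]mul1r -mulrBl mulf_eq0 subr_eq0 eq_sym.
  by rewrite unit_sing_vals ltnNge pi => /eqP.
by rewrite subr_ge0 ler_piMl// sing_vals_le1.
Qed.

Lemma num_unit_le : (p <= m)%N.
Proof. by rewrite /p /num_unit_sing_vals -[X in (_ <= X)%N]card_ord max_card. Qed.

(** The left and right singular vectors of [Y] for the singular value one. *)
Definition frameL : 'M[R]_(m, p) := U *m pid_mx p.
Definition frameR : 'M[R]_(n, p) := V *m pid_mx p.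

Lemma frameL_orth : frameL^T *m frameL = 1%:M.
Proof.
rewrite trmx_mul mulmxA -(mulmxA _ U^T) U1 mulmx1 tr_pid_mx mul_pid_mx.
by rewrite minnn (minn_idPr num_unit_le) pid_mx_1.
Qed.

Lemma frameR_orth : frameR^T *m frameR = 1%:M.
Proof.
have pn := leq_trans num_unit_le hmn.
rewrite trmx_mul mulmxA -(mulmxA _ V^T) V1 mulmx1 tr_pid_mx mul_pid_mx.
by rewrite minnn (minn_idPr pn) pid_mx_1.
Qed.

Lemma frame_block (A : 'M[R]_p) :
  U *m (pid_mx p *m A *m pid_mx p) *m V^T = frameL *m A *m frameR^T.
Proof. by rewrite trmx_mul tr_pid_mx !mulmxA. Qed.

Lemma diag_sing_vals_pid k :
  diag_mx (sing_vals Y) *m pid_mx p = pid_mx p :> 'M[R]_(m, k).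
Proof.
apply/matrixP => i j; rewrite mul_diag_mx !mxE -unit_sing_vals.
by have [->|_] := eqVneq (sing_vals Y 0 i) 1; rewrite ?mul1r// andbF mulr0.
Qed.

Lemma mul_diag_pid s k : (forall i : 'I_m, (p <= i)%N -> s 0 i = 0) ->
  diag_mx s *m pid_mx p = diag_mx s *m pid_mx m :> 'M[R]_(m, k).
Proof.
move=> s0; apply/matrixP => i j; rewrite !mul_diag_mx !mxE ltn_ord.
by have [_|/s0 ->] := ltnP i p; rewrite // !mul0r.
Qed.

Lemma mulmx_frameR : Y *m frameR = frameL.
Proof.
by rewrite YE -(mulmxA _ V^T) (mulmxA V^T) V1 mul1mx rect_diagE -!mulmxA
  mul_pid_mx (minn_idPr num_unit_le) (minn_idPr (leq_trans num_unit_le hmn))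
  diag_sing_vals_pid.
Qed.

Lemma mulmx_frameL : Y^T *m frameL = frameR.
Proof.
rewrite YE !trmx_mul trmxK -!mulmxA (mulmxA U^T) U1 mul1mx.
rewrite rect_diagE trmx_mul tr_diag_mx tr_pid_mx -mulmxA diag_sing_vals_pid.
by rewrite mul_pid_mx !(minn_idPr num_unit_le).
Qed.

(** In the basis [U] the equation reads [G i j = s_i^2 G i j], which leaves only
    the rows with [s_i = 1]. *)
Lemma frame_proj k (H : 'M[R]_(m, k)) : H = Y *m (Y^T *m H) ->
  H = frameL *m (frameL^T *m H).
Proof.
have U1' := mulmx1C U1; move=> HE.
pose G := U^T *m H; have HG : H = U *m G by rewrite mulmxA U1' mul1mx.
have GE : G = diag_mx (\row_i (sing_vals Y 0 i * sing_vals Y 0 i)) *m G.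
  rewrite {1}/G HE mulmxA; have := YE; move: (sing_vals Y) => s ->.
  rewrite !trmx_mul trmxK -!mulmxA (mulmxA U^T) U1 mul1mx (mulmxA V^T) V1 mul1mx.
  rewrite -/G rect_diagE trmx_mul -!mulmxA (mulmxA (pid_mx m)) pid_mx_orth mul1mx.
  by rewrite tr_diag_mx mulmxA mulmx_diag.
clearbody G.
have PG : (pid_mx p : 'M[R]_m) *m G = G.
  have -> : (pid_mx p : 'M[R]_m) = diag_mx (\row_i (i < p)%N%:R).
    by apply/matrixP => i j; rewrite !mxE -val_eqE /=; case: eqP => // ->.
  apply/matrixP => i j; rewrite mul_diag_mx mxE [(\row_i _) _ _]mxE.
  have [|ip] := ltnP i p; first by rewrite mul1r.
  move/matrixP: GE => /(_ i j); rewrite mul_diag_mx [RHS]mxE [(\row_i _) _ _]mxE.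
  move=> Gij; rewrite mul0r; have [s0 _ _] := sing_valsP Y.
  have /eqP : (1 - sing_vals Y 0 i * sing_vals Y 0 i) * G i j = 0.
    by rewrite mulrBl mul1r -Gij subrr.
  rewrite mulf_eq0 => /orP[|/eqP->//]; rewrite subr_eq0 eq_sym -expr2.
  by rewrite sqrp_eq1// unit_sing_vals ltnNge ip.
have GU : U^T *m H = G by rewrite HG mulmxA U1 mul1mx.
rewrite /frameL trmx_mul tr_pid_mx -!mulmxA GU {1}HG -{1}PG; congr (U *m _).
by rewrite !mulmxA mul_pid_mx !minnn.
Qed.

Lemma frame_base : exists2 B : 'M[R]_p, X = frameL *m B *m frameR^T &
  B^T = B /\ forall v : 'cV[R]_p, 0 <= frob_dot v (B *m v).
Proof.
have [s0 _ _] := sing_valsP X.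
exists (pid_mx p *m diag_mx (sing_vals X) *m pid_mx p).
  rewrite -frame_block {1}XE; congr (_ *m _ *m _).
  rewrite !mulmxA mul_pid_mx !minnn.
  rewrite -[RHS]mulmxA mul_pid_mx !minnn.
  have -> : pid_mx p *m diag_mx (sing_vals X) = diag_mx (sing_vals X) :> 'M[R]_m.
    apply: trmx_inj; rewrite trmx_mul tr_diag_mx tr_pid_mx.
    by rewrite (mul_diag_pid _ sing_vals_supp) pid_mx_1 mulmx1.
  by rewrite (mul_diag_pid _ sing_vals_supp) rect_diagE.
split; first by rewrite !trmx_mul tr_diag_mx !tr_pid_mx mulmxA.
move=> v; rewrite -!mulmxA.
have {1}-> : (pid_mx p : 'M[R]_(p, m)) = (pid_mx p : 'M[R]_(m, p))^T.
  by rewrite tr_pid_mx.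
rewrite -frob_dot_mulmxl; move: (pid_mx p *m v) => w.
rewrite frob_dotE; apply: sumr_ge0 => i _; apply: sumr_ge0 => j _.
by rewrite mul_diag_mx mxE mulrCA mulr_ge0// -expr2 sqr_ge0.
Qed.

End Frame.

(** By symmetry of [Y^T H], the range condition [H = P P^T H] on the left also
    confines [H] to the columns of [Q] on the right. *)
Lemma sym_block_of_residuals {R : realType} m n p (Y H : 'M[R]_(m, n))
    (P : 'M[R]_(m, p)) (Q : 'M[R]_(n, p)) :
  P^T *m P = 1%:M -> Q^T *m Q = 1%:M -> Y^T *m P = Q ->
  H = P *m (P^T *m H) -> polar_res Y H = 0 -> skew_res Y H = 0 ->
  exists2 A : 'M[R]_p, A^T = A & H = P *m A *m Q^T.
Proof.
move=> P1 Q1 YP HP.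
move=> /eqP; rewrite subr_eq0 => /eqP HE /eqP; rewrite subr_eq0 => /eqP HT.
have PY : P^T *m Y = Q^T by rewrite -YP trmx_mul trmxK.
have HTP : H^T = H^T *m P *m P^T by rewrite {1}HP !trmx_mul trmxK.
have HA : H = P *m (Q^T *m H^T *m P) *m Q^T.
  rewrite {1}HP {1}HE HT (mulmxA P^T Y) PY {1}HTP -(mulmxA _ P^T) PY.
  by rewrite !mulmxA.
exists (Q^T *m H^T *m P) => //.
rewrite !trmx_mul !trmxK {1}HA !mulmxA P1 mul1mx.
by rewrite -!mulmxA Q1 mulmx1.
Qed.

(** * Convex functions of class C2 *)

Section Calculus.
Context {R : realType} {m n : nat}.
Notation M := 'M[R]_(m, n).
Implicit Types X Y Z H K : M.

Lemma MVT_line (F : M -> R^o) X K : (forall Z, differentiable F Z) ->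
  exists2 t : R, 0 < t < 1 & F (X + K) - F X = 'd F (X + t *: K) K.
Proof.
move=> dF; pose g (t : R) : R := F (X + t *: K).
have gE (t : R) : (fun h : R => h^-1 *: (g (h *: 1 + t) - g t)) =
    (fun h => h^-1 *: (F (h *: K + (X + t *: K)) - F (X + t *: K))).
  apply/funext => h; rewrite /g [h *: 1]mulr1 scalerDl.
  by rewrite addrCA.
have dg (t : R) : is_derive t (1 : R) g ('d F (X + t *: K) K).
  have FD := @diff_derivable _ _ _ F (X + t *: K) K (dF _).
  apply: DeriveDef.
    by rewrite /derivable gE.
  by rewrite -deriveE// /derive gE.
have [|c c01] := @MVT R g (fun t => 'd F (X + t *: K) K) 0 1 ltr01
    (fun t _ => dg t).
  apply/continuous_subspaceT => t; apply/differentiable_continuous.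
  by apply/derivable1_diffP; have [] := dg t.
rewrite /g scale1r scale0r addr0 subr0 mulr1 => E; exists c => //.
Qed.

Lemma frob_dot_linear Y : linear (frob_dot Y : M -> R^o).
Proof. by move=> a H K; rewrite frob_dotDr frob_dotZr. Qed.

Variable f : M -> R.
Hypotheses (C2 : twice_continuously_differentiable f)
  (cf : convex_function (setT : set M) f).

Lemma frob_dot_gradient X H : frob_dot (gradient f X) H = 'd (f : M -> R^o) X H.
Proof.
rewrite [in RHS](matrix_sum_delta H) linear_sum frob_dotE.
apply: eq_bigr => i _; rewrite linear_sum; apply: eq_bigr => j _.
by rewrite linearZ mxE mulrC.
Qed.

Lemma MVT_fun X K : exists2 t : R, 0 < t < 1 &
  f (X + K) - f X = frob_dot (gradient f (X + t *: K)) K.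
Proof.
have [df _ _] := C2; have [t t01 E] := MVT_line X K df.
by exists t => //; rewrite frob_dot_gradient.
Qed.

Lemma MVT_gradient X K H : exists2 t : R, 0 < t < 1 &
  frob_dot H (gradient f (X + K) - gradient f X) =
  frob_dot H (hessian f (X + t *: K) K).
Proof.
have [_ dg _] := C2.
pose L : {linear M -> R^o} := HB.pack (frob_dot H : M -> R^o)
  (GRing.isLinear.Build _ _ _ _ _ (frob_dot_linear H)).
have Lc : continuous L by exact: continuous_frob_dot.
have dL Z : differentiable (L \o gradient f) Z.
  by apply: differentiable_comp => //; exact: linear_differentiable.
have [t t01 E] := MVT_line X K dL; exists t => //.
rewrite frob_dotBr; move: E; rewrite diff_comp//.
  by rewrite (diff_lin _ Lc).
exact: (@linear_differentiable _ _ _ L).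
Qed.

Lemma MVT_gradient_scaled X K H t : exists2 s : R, 0 < s < 1 &
  frob_dot H (gradient f (X + t *: K)) - frob_dot H (gradient f X) =
  t * frob_dot H (hessian f (X + s *: (t *: K)) K).
Proof.
have [s s01 E] := MVT_gradient X (t *: K) H; exists s => //.
by rewrite -frob_dotBr E linearZ frob_dotZr.
Qed.

Lemma continuous_gradient : continuous (gradient f).
Proof. by have [_ dg _] := C2; move=> X; exact: differentiable_continuous. Qed.

Lemma continuous_fun : continuous (f : M -> R).
Proof. by have [df _ _] := C2; move=> X; exact: differentiable_continuous. Qed.

Lemma continuous_dot_gradient H : continuous (fun X => frob_dot H (gradient f X)).
Proof.
move=> X; apply: continuous_comp; first exact: continuous_gradient.
exact: continuous_frob_dot.
Qed.

Lemma continuous_dot_hessian H K : continuous (fun X => frob_dot H (hessian f X K)).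
Proof.
have [_ _ ch] := C2; move=> X; apply: continuous_comp; first exact: ch.
exact: continuous_frob_dot.
Qed.

Lemma small_step (L r : R) : 0 <= L -> 0 < r ->
  exists2 t : R, 0 < t < 1 & forall X K s, frob_norm K <= L -> 0 <= s <= 1 ->
    frob_ball X r (X + s *: (t *: K)).
Proof.
move=> L0 r0; have d0 : 0 < L + 1 + r by lra.
exists (r / (L + 1 + r)); first by rewrite divr_gt0//= ltr_pdivrMr//; lra.
move=> X K s KL /andP[s0 s1].
rewrite /frob_ball/= (addrC X) addrK !frob_normZ (ger0_norm s0).
rewrite (ger0_norm (divr_ge0 (ltW r0) (ltW d0))).
apply: (@le_lt_trans _ _ (r / (L + 1 + r) * L)).
  have c0 : 0 <= r / (L + 1 + r) by rewrite divr_ge0 ?ltW.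
  apply: le_trans (ler_wpM2l c0 KL).
  by rewrite ler_piMl// mulr_ge0 ?frob_norm_ge0.
by rewrite mulrAC ltr_pdivrMr//; nra.
Qed.

(** Passage to the limit in the mean value theorem: it only provides an
    unspecified intermediate point on each short segment. *)
Lemma le_closure (a : M -> R) c X : continuous a ->
  (forall r : R, 0 < r -> exists2 Z, frob_ball X r Z & a Z <= c) -> a X <= c.
Proof.
move=> ac h; rewrite leNgt; apply/negP => a0.
have [|r r0 rA] := continuous_frobP (ac X) (e := a X - c); first by rewrite subr_gt0.
have [Z /rA + aZ] := h r r0; rewrite ltr_norml; lra.
Qed.

Lemma convex_segment X Z t : 0 <= t <= 1 ->
  f (X + t *: (Z - X)) <= (1 - t) * f X + t * f Z.
Proof.
move=> /andP[t0 t1]; rewrite [leRHS]addrC.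
have -> : X + t *: (Z - X) = t *: Z + (1 - t) *: X.
  by rewrite scalerBr scalerBl scale1r addrCA addrA.
by apply: (cf (Itv01 t0 t1)); exact: in_setT.
Qed.

Lemma convex_gradient X Z : f X + frob_dot (gradient f X) (Z - X) <= f Z.
Proof.
suff : frob_dot (Z - X) (gradient f X) <= f Z - f X by rewrite frob_dotC; lra.
apply: (@le_closure (fun W => frob_dot (Z - X) (gradient f W))).
  exact: continuous_dot_gradient.
move=> r r0; have [t /andP[t0 t1] tr] := small_step (frob_norm_ge0 (Z - X)) r0.
have [s /andP[s0 s1] sE] := MVT_fun X (t *: (Z - X)).
exists (X + s *: (t *: (Z - X))); first by apply: tr; rewrite // (ltW s0) ltW.
have := @convex_segment X Z t; rewrite (ltW t0) (ltW t1) => /(_ isT) h.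
rewrite -(ler_pM2l t0); move: sE; rewrite frob_dotZr frob_dotC.
lra.
Qed.

Lemma gradient_monotone X H : 0 <= frob_dot H (gradient f (X + H) - gradient f X).
Proof.
have := convex_gradient X (X + H); have := convex_gradient (X + H) X.
have -> : X + H - X = H by rewrite addrC addKr.
have -> : X - (X + H) = - H by rewrite opprD addNKr.
move: (gradient f X) (gradient f (X + H)) (f X) (f (X + H)) => u v c d.
rewrite frob_dotNr frob_dotBr !(frob_dotC H).
by move: (frob_dot u H) (frob_dot v H) => a b; lra.
Qed.

Lemma hessian_psd X H : 0 <= frob_dot H (hessian f X H).
Proof.
rewrite -oppr_le0 -frob_dotNl.
apply: (@le_closure (fun W => frob_dot (- H) (hessian f W H))).
  exact: continuous_dot_hessian.
move=> r r0; have [t /andP[t0 t1] tr] := small_step (frob_norm_ge0 H) r0.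
have [s /andP[s0 s1] sE] := MVT_gradient X (t *: H) H.
exists (X + s *: (t *: H)); first by apply: tr; rewrite // (ltW s0) ltW.
have := gradient_monotone X (t *: H).
by rewrite frob_dotNl oppr_le0 frob_dotZl pmulr_rge0// sE linearZ frob_dotZr pmulr_rge0.
Qed.

(** Adding the gradient inequalities from [X] to [X + t H], from there to
    [X + t K], and back to [X] cancels the values of [f] and leaves an inequality
    between increments of the gradient, each of order [t^2]. *)
Lemma hessian_cross X H K : frob_dot K (hessian f X H) <=
  frob_dot K (hessian f X K) + frob_dot H (hessian f X H).
Proof.
rewrite leNgt; apply/negP => lt0.
set g := frob_dot K (hessian f X H) in lt0.
set a := frob_dot K (hessian f X K) in lt0.
set b := frob_dot H (hessian f X H) in lt0.
(* Each of the three Hessian terms may move by a third of the assumed gap. *)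
have e0 : 0 < (g - a - b) / 3 by lra.
have [r1 r10 c1] : exists2 r : R, 0 < r & forall W, frob_ball X r W ->
    `|frob_dot K (hessian f W K) - a| < (g - a - b) / 3.
  exact: continuous_frobP (@continuous_dot_hessian K K X) _ e0.
have [r2 r20 c2] : exists2 r : R, 0 < r & forall W, frob_ball X r W ->
    `|frob_dot K (hessian f W H) - g| < (g - a - b) / 3.
  exact: continuous_frobP (@continuous_dot_hessian K H X) _ e0.
have [r3 r30 c3] : exists2 r : R, 0 < r & forall W, frob_ball X r W ->
    `|frob_dot H (hessian f W H) - b| < (g - a - b) / 3.
  exact: continuous_frobP (@continuous_dot_hessian H H X) _ e0.
pose r := Num.min r1 (Num.min r2 r3).
have r0 : 0 < r by rewrite !lt_min r10 r20 r30.
have L0 : 0 <= frob_norm H + frob_norm K by rewrite addr_ge0 ?frob_norm_ge0.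
have [t /andP[t0 t1] tr] := small_step L0 r0.
have HL : frob_norm H <= frob_norm H + frob_norm K by rewrite lerDl frob_norm_ge0.
have KL : frob_norm K <= frob_norm H + frob_norm K by rewrite lerDr frob_norm_ge0.
have {}tr s Z : frob_norm Z <= frob_norm H + frob_norm K -> 0 < s < 1 ->
    [/\ frob_ball X r1 (X + s *: (t *: Z)), frob_ball X r2 (X + s *: (t *: Z))
      & frob_ball X r3 (X + s *: (t *: Z))].
  move=> ZL /andP[s0 s1]; have := tr X Z s ZL; rewrite (ltW s0) (ltW s1) => /(_ isT).
  by rewrite /frob_ball/= !lt_min => /and3P[].
have [s1 s101 E1] := MVT_gradient_scaled X K K t.
have [s2 s201 E2] := MVT_gradient_scaled X H K t.
have [s3 s301 E3] := MVT_gradient_scaled X H H t.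
have [/c1 h1 _ _] := tr _ _ KL s101.
have [_ /c2 h2 _] := tr _ _ HL s201.
have [_ _ /c3 h3] := tr _ _ HL s301.
have := convex_gradient (X + t *: H) (X + t *: K).
have := convex_gradient X (X + t *: H).
have := convex_gradient (X + t *: K) X.
have -> : X + t *: H - X = t *: H by rewrite addrC addKr.
have -> : X - (X + t *: K) = - (t *: K) by rewrite opprD addNKr.
have -> : X + t *: K - (X + t *: H) = t *: K - t *: H by rewrite opprD addrACA subrr add0r.
move: E1 E2 E3 h1 h2 h3; rewrite !ltr_norml.
move: (frob_dot K (hessian f (X + s1 *: (t *: K)) K)) => u1.
move: (frob_dot K (hessian f (X + s2 *: (t *: H)) H)) => u2.
move: (frob_dot H (hessian f (X + s3 *: (t *: H)) H)) => u3.
move: (f (X + t *: H)) (f (X + t *: K)) (f X) => y1 y2 y3.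
move: (gradient f X) (gradient f (X + t *: H)) (gradient f (X + t *: K)).
move=> G1 G2 G3; rewrite !(frob_dotNr, frob_dotBr, frob_dotZr).
rewrite !(frob_dotC G1) !(frob_dotC G2) !(frob_dotC G3).
move: (frob_dot K G1) (frob_dot H G1) (frob_dot K G2) => x1 x2 x3.
move: (frob_dot H G2) (frob_dot K G3) => x4 x5.
move=> E1 E2 E3 /andP[h1 h1'] /andP[h2 h2'] /andP[h3 h3'] i3 i2 i1.
have : t * (t * u2) <= t * (t * u1) + t * (t * u3).
  by rewrite -E1 -E2 -E3; lra.
by rewrite -!mulrDr !ler_pM2l//; lra.
Qed.

(** [hessian_cross] for [K = c B] with [B] the image of [H] reads
    [c |B|^2 <= c^2 <B, Hess B>], which for small [c] forces [B = 0].  This uses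
    convexity in place of the symmetry of the Hessian. *)
Lemma hessian_ker_of_dot0 X H : frob_dot H (hessian f X H) = 0 -> hessian f X H = 0.
Proof.
move=> H0; apply: frob_dot_eq0.
set B := hessian f X H; set q := frob_dot B (hessian f X B).
have q0 : 0 <= q by exact: hessian_psd.
apply/eqP; rewrite eq_le frob_dot_ge0 andbT leNgt; apply/negP => b0.
set b := frob_dot B B in b0; pose c := b / (2 * (1 + q)).
have c0 : 0 < c by rewrite divr_gt0//; lra.
have := hessian_cross X H (c *: B); rewrite H0 addr0 linearZ !frob_dotZl frob_dotZr.
rewrite -/B -/q -/b ler_pM2l// /c mulrAC ler_pdivlMr; nra.
Qed.

End Calculus.

(** * From tilt stability to the kernel condition *)

Section TiltStability.
Context {R : realType} {m n : nat}.
Notation M := 'M[R]_(m, n).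
Implicit Types X Y Z H K W : M.

Lemma continuous_frob_mxP (g : M -> M) X K : {for X, continuous g} -> g X = K ->
  forall e, 0 < e -> exists2 r : R, 0 < r &
    forall Z, frob_ball X r Z -> frob_norm (g Z - K) < e.
Proof.
move=> gc <- e e0.
have : nbhs (g X) (frob_ball (g X) e) by apply/nbhs_frobP; exists e.
by move=> /gc /nbhs_frobP[r r0 rA]; exists r.
Qed.

Variable f : M -> R.
Hypotheses (C2 : twice_continuously_differentiable f)
  (cf : convex_function (setT : set M) f).

(** The sum of the gradient inequality for [f] and the subgradient inequality for
    the nuclear norm. *)
Lemma argmin_of_subgradient X Y : contractive Y -> defect Y X = 0 ->
  is_global_min (fun Z => f Z + nuclear_norm Z - frob_dot (gradient f X + Y) Z) X.
Proof.
move=> Yc /eqP; rewrite subr_eq0 => /eqP XY Z; rewrite XY !frob_dotDl.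
have := nuclear_norm_contraction Z Yc; have := convex_gradient C2 cf X Z.
move: (gradient f X) => G; rewrite frob_dotBr.
move: (frob_dot G _) (frob_dot G _) (frob_dot Y _) (frob_dot Y _) => a b c d.
move: (f X) (f Z) (nuclear_norm Z) => x y z; lra.
Qed.

Section Necessity.
Variables (X Y : M) (p : nat) (P : 'M[R]_(m, p)) (Q : 'M[R]_(n, p)).
Hypotheses (P1 : P^T *m P = 1%:M) (Q1 : Q^T *m Q = 1%:M) (YQ : Y *m Q = P)
  (Yc : contractive Y).

(** On the matrices [P B Q^T] with [B] positive semidefinite, the nuclear norm is
    the trace of [B], which is the linear form given by [Y]. *)
Lemma defect_psd_block (B : 'M[R]_p) :
  B^T = B -> (forall v : 'cV[R]_p, 0 <= frob_dot v (B *m v)) ->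
  defect Y (P *m B *m Q^T) = 0.
Proof.
move=> BT B0; apply/eqP; rewrite eq_le defect_ge0// andbT subr_le0.
have -> : frob_dot Y (P *m B *m Q^T) = \tr B.
  rewrite frob_dotC frob_dot_mulmxr trmxK YQ frob_dot_mulmxl P1.
  by rewrite /frob_dot mulmx1 mxtrace_tr.
exact: nuclear_norm_psd.
Qed.

(** The mean value theorem for the pairing of the gradient with its own
    increment. *)
Lemma gradient_lipschitz_line Z K t e : 0 <= t ->
  (forall s : R, 0 < s < 1 -> frob_norm (hessian f (Z + s *: (t *: K)) K) <= e) ->
  frob_norm (gradient f (Z + t *: K) - gradient f Z) <= t * e.
Proof.
move=> t0 he; set G := _ - _.
have [s s01] := MVT_gradient_scaled C2 Z K G t.
rewrite -frob_dotBr -/G -frob_normE.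
move: (he s s01); move: (hessian _ _ _) => W We E.
have [->|G0] := eqVneq G 0.
  by rewrite frob_norm0 mulr_ge0//; exact: le_trans (frob_norm_ge0 _) We.
rewrite -(ler_pM2l (frob_norm_gt0 G0)) -expr2 E mulrCA ler_wpM2l//.
by rewrite (le_trans (frob_CS _ _))// ler_wpM2l// frob_norm_ge0.
Qed.

Variables (B A : 'M[R]_p).
Hypotheses (XE : X = P *m B *m Q^T) (BT : B^T = B)
  (B0 : forall v : 'cV[R]_p, 0 <= frob_dot v (B *m v)) (AT : A^T = A).

Lemma psd_perturb (e t : R) (v : 'cV[R]_p) : 0 <= e -> 0 <= t -> t * frob_norm A <= 1 ->
  0 <= frob_dot v ((B + e *: 1%:M + e *: (t *: A)) *m v).
Proof.
move=> e0 t0 tA; rewrite !mulmxDl -!scalemxAl mul1mx !frob_dotDr !frob_dotZr.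
rewrite -addrA -mulrDr addr_ge0 ?mulr_ge0// -frob_normE.
have := frob_CS_abs v (A *m v); rewrite ler_norml => /andP[h _].
have h2 := frob_norm_mulmx A v; have v0 := frob_norm_ge0 v.
have h3 : - (t * (frob_norm v * (frob_norm A * frob_norm v))) <= t * frob_dot v (A *m v).
  rewrite -mulrN ler_wpM2l//; apply: le_trans h; rewrite lerN2 ler_wpM2l//.
move: (frob_dot v _) h3 => d; move: (frob_norm v) (frob_norm A) v0 tA => a b a0 tb.
move=> h3; apply: le_trans (_ : a ^+ 2 - (t * b) * a ^+ 2 <= _); last lra.
by rewrite subr_ge0 ler_piMl// sqr_ge0.
Qed.

(** The points [X + e (P Q^T + s H)] with [0 <= s <= t] all minimize a tilted
    objective, with tilts [gradient f _ + Y] that tend to zero with [e]; compare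
    [s = 0] with [s = t]. *)
Lemma tilt_stable_kernel : Y = - gradient f X ->
  tilt_stable (fun Z => f Z + nuclear_norm Z) X ->
  hessian f X (P *m A *m Q^T) = 0 -> P *m A *m Q^T = 0.
Proof.
move=> YE [gam [gam0 [N [g [L [N0 Ng gL _]]]]]].
set H := P *m A *m Q^T => hH.
apply/eqP/negP => /negP H0; have Hn := frob_norm_gt0 H0.
have /nbhs_frobP[rho rho0 rhoN] := N0.
have [_ _ hc] := C2.
have [r1 r10 b1] := continuous_frob_mxP (@continuous_gradient _ _ _ _ C2 X) erefl rho0.
have L1 : 0 < `|L| + 1 by rewrite ltr_wpDl.
have [r2 r20 b2] := continuous_frob_mxP (hc H X) hH (divr_gt0 Hn L1).
pose r := Num.min gam (Num.min r1 r2).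
have r0 : 0 < r by rewrite !lt_min gam0 r10 r20.
have rP Z : frob_ball X r Z ->
    [/\ frob_ball X gam Z, frob_ball X r1 Z & frob_ball X r2 Z].
  by rewrite /frob_ball/= !lt_min => /and3P[].
pose E := P *m Q^T.
have [e /andP[e0 e1] eP] := small_step (m := m) (n := n)
  (addr_ge0 (frob_norm_ge0 E) (frob_norm_ge0 H)) r0.
pose t := (1 + frob_norm A)^-1.
have A1 : 0 < 1 + frob_norm A by rewrite ltr_pwDl ?frob_norm_ge0.
have t0 : 0 < t by rewrite invr_gt0.
have tA : t * frob_norm A <= 1 by rewrite mulrC ler_pdivrMr// mul1r lerDr.
have t1 : t <= 1 by rewrite invf_le1// lerDl frob_norm_ge0.
have ZE s : X + e *: (E + s *: H) = P *m (B + e *: 1%:M + e *: (s *: A)) *m Q^T.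
  rewrite !mulmxDr !mulmxDl -XE scalerDr addrA -!scalemxAr -!scalemxAl mulmx1.
  by [].
have Zb s : 0 <= s <= 1 -> frob_ball X r (X + e *: (E + s *: H)).
  move=> /andP[s0 s1]; rewrite -[e *: _]scale1r; apply: eP; rewrite ?ler01 ?lexx//.
  rewrite (le_trans (frob_normD _ _))// lerD2l frob_normZ ger0_norm//.
  by rewrite ler_piMl// frob_norm_ge0.
have Zg s : 0 <= s -> s <= t ->
    let Z := X + e *: (E + s *: H) in let V := gradient f Z + Y in
    N V /\ Z = g V.
  move=> s0 st Z V.
  have [Zgam Zr1 _] : [/\ frob_ball X gam Z, frob_ball X r1 Z & frob_ball X r2 Z].
    by apply/rP/Zb; rewrite s0 (le_trans st).
  have VN : N V.
    by apply: rhoN; rewrite /frob_ball/= subr0 /V YE; exact: b1.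
  split=> //; suff : [set g V] Z by [].
  rewrite -Ng//; split=> // W _.
  apply: argmin_of_subgradient => //; rewrite /Z ZE; apply: defect_psd_block.
    by rewrite !linearD /= !linearZ /= linearZ /= BT AT trmx1.
  move=> v; apply: psd_perturb => //; first exact: ltW.
  by rewrite (le_trans _ tA)// ler_wpM2r// frob_norm_ge0.
(* The tilts of two such points differ by the increment of the gradient. *)
have lip (G1 G2 Z1 Z2 : M) : N (G1 + Y) /\ Z1 = g (G1 + Y) ->
    N (G2 + Y) /\ Z2 = g (G2 + Y) -> frob_norm (Z2 - Z1) <= L * frob_norm (G2 - G1).
  move=> [N1 ->] [N2 ->]; rewrite (le_trans (gL _ _ N2 N1))//.
  by rewrite opprD addrACA subrr addr0.
pose Z := X + e *: (E + 0 *: H).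
have ZtE : X + e *: (E + t *: H) = Z + (e * t) *: H.
  by rewrite /Z scale0r addr0 scalerDr scalerA addrA.
have := lip _ _ _ _ (Zg 0 (lexx _) (ltW t0)) (Zg t (ltW t0) (lexx _)).
rewrite ZtE -/Z => {}lip.
have het : 0 <= e * t by rewrite mulr_ge0 ?ltW.
have hb s : 0 < s < 1 ->
    frob_norm (hessian f (Z + s *: ((e * t) *: H)) H) <= frob_norm H / (`|L| + 1).
  move=> /andP[s0 s1]; apply/ltW.
  have /rP[_ _] : frob_ball X r (Z + s *: ((e * t) *: H)).
    have -> : Z + s *: ((e * t) *: H) = X + e *: (E + (s * t) *: H).
      rewrite /Z scale0r addr0 -addrA; congr (_ + _).
      by rewrite scalerDr !scalerA mulrCA mulrA.
    by apply: Zb; rewrite mulr_ge0 ?mulr_ile1// ltW.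
  by move=> /b2; rewrite subr0.
have := gradient_lipschitz_line het hb; move: lip.
move: (gradient f _) (gradient f _) => G1 G2.
rewrite (addrC Z) addrK frob_normZ ger0_norm// => lip glip.
have et : 0 < e * t by rewrite mulr_gt0.
have : e * t * frob_norm H <= `|L| * (e * t * (frob_norm H / (`|L| + 1))).
  apply: le_trans lip _; apply: le_trans (ler_wpM2r (frob_norm_ge0 _) (ler_norm L)) _.
  exact: ler_wpM2l.
rewrite mulrCA ler_pM2l// mulrCA leNgt => /negP; apply.
by rewrite gtr_pMr// ltr_pdivrMr// mul1r ltrDl.
Qed.

End Necessity.
End TiltStability.

(** * Coercivity and perturbation of quadratic forms *)

Section PositiveDefinite.
Context {R : realType}.

Lemma frob_dot_mxvec m n (X Y : 'M[R]_(m, n)) :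
  frob_dot (mxvec X) (mxvec Y) = frob_dot X Y.
Proof.
rewrite !frob_dotE big_ord1.
rewrite pair_bigA /= (reindex _ (curry_mxvec_bij _ _)) /=.
by apply: eq_bigr => -[i j] _ /=; rewrite !mxvecE.
Qed.

(** The smallest eigenvalue would do as the bound; the inverse of one plus the
    sum of the inverse eigenvalues is below it and also exists in size zero. *)
Lemma posdef_bound k (S : 'M[R]_k) : S^T = S ->
  (forall v : 'rV[R]_k, v != 0 -> 0 < frob_dot v (v *m S)) ->
  exists2 c : R, 0 < c & forall v : 'rV[R]_k, c * frob_dot v v <= frob_dot v (v *m S).
Proof.
move=> ST S0; have [K [d K1 SE]] := sym_spectral ST.
have K1' := mulmx1C K1.
have qE (v : 'rV[R]_k) : frob_dot v (v *m S) = \sum_i d 0 i * (v *m K) 0 i ^+ 2.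
  rewrite SE !mulmxA -frob_dot_mulmxr frob_dotE big_ord1; apply: eq_bigr => i _.
  by rewrite mul_mx_diag [in X in _ * X]mxE mulrA -expr2 mulrC.
have d0 i : 0 < d 0 i.
  pose e : 'rV[R]_k := delta_mx 0 i.
  have eK : e *m K^T *m K = e by rewrite -mulmxA K1 mulmx1.
  have := S0 (e *m K^T); rewrite qE eK (bigD1 i)//= big1 => [|j ji].
    rewrite mxE !eqxx expr1n mulr1 addr0; apply.
    apply/eqP => eK0; move: eK; rewrite eK0 mul0mx => /matrixP/(_ 0 i)/eqP.
    by rewrite !mxE !eqxx eq_sym oner_eq0.
  by rewrite mxE (negPf ji) andbF expr0n mulr0.
have s0 : 0 < 1 + \sum_i (d 0 i)^-1.
  by rewrite ltr_pwDl// sumr_ge0// => i _; rewrite invr_ge0 ltW.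
exists (1 + \sum_i (d 0 i)^-1)^-1; first by rewrite invr_gt0.
move=> v; have -> : frob_dot v v = frob_dot (v *m K) (v *m K).
  by rewrite frob_dot_mulmxr -mulmxA K1' mulmx1.
rewrite qE frob_dotE big_ord1 mulr_sumr; apply: ler_sum => i _.
rewrite -expr2 ler_wpM2r ?sqr_ge0// invf_ple ?posrE//.
rewrite (bigD1 i)//= addrCA lerDl addr_ge0// sumr_ge0// => j _.
by rewrite invr_ge0 ltW.
Qed.

(** Written in coordinates, the right-hand side is the quadratic form of a
    symmetric matrix, which the hypotheses make positive definite. *)
Lemma coercive m n k l k' l' (T0 : {linear 'M[R]_(m, n) -> 'M[R]_(m, n)})
    (T1 : {linear 'M[R]_(m, n) -> 'M[R]_(k, l)})
    (T2 : {linear 'M[R]_(m, n) -> 'M[R]_(k', l')}) :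
  (forall H, 0 <= frob_dot H (T0 H)) ->
  (forall H, frob_dot H (T0 H) = 0 -> T1 H = 0 -> T2 H = 0 -> H = 0) ->
  exists2 c : R, 0 < c & forall H, c * frob_norm H ^+ 2 <=
    frob_dot H (T0 H) + frob_norm (T1 H) ^+ 2 + frob_norm (T2 H) ^+ 2.
Proof.
move=> T0p inj.
pose q H := frob_dot H (T0 H) + frob_norm (T1 H) ^+ 2 + frob_norm (T2 H) ^+ 2.
pose L0 := lin_mx T0; pose L1 := lin_mx T1; pose L2 := lin_mx T2.
pose S := 2^-1 *: (L0 + L0^T) + L1 *m L1^T + L2 *m L2^T.
have qE (v : 'rV[R]_(m * n)) : frob_dot v (v *m S) = q (vec_mx v).
  have lE a b (T : {linear 'M[R]_(m, n) -> 'M[R]_(a, b)}) :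
      mxvec (T (vec_mx v)) = v *m lin_mx T.
    by rewrite -mul_vec_lin vec_mxK.
  rewrite /q !frob_normE -(frob_dot_mxvec (vec_mx v)) -(frob_dot_mxvec (T1 _)).
  rewrite -(frob_dot_mxvec (T2 _)) !lE !vec_mxK.
  rewrite /S !mulmxDr -scalemxAr !frob_dotDr frob_dotZr mulmxDr frob_dotDr.
  rewrite !frob_dot_mulmxr -(mulmxA v L1) -(mulmxA v L2).
  have -> : frob_dot v (v *m L0^T) = frob_dot v (v *m L0).
    by rewrite -frob_dot_mulmxr frob_dotC.
  by congr (_ + _ + _); field.
have ST : S^T = S.
  have trD (A C : 'M[R]_(m * n)) : (A + C)^T = A^T + C^T by rewrite linearD.
  have trZ a (A : 'M[R]_(m * n)) : (a *: A)^T = a *: A^T by rewrite linearZ.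
  by rewrite /S !(trD, trZ) !trmx_mul !trmxK (addrC L0^T).
have q0 (v : 'rV[R]_(m * n)) : v != 0 -> 0 < frob_dot v (v *m S).
  move=> v0; rewrite qE /q.
  have h0 := T0p (vec_mx v); have h1 := sqr_ge0 (frob_norm (T1 (vec_mx v))).
  have h2 := sqr_ge0 (frob_norm (T2 (vec_mx v))).
  rewrite lt_def !addr_ge0// andbT; apply: contra v0 => /eqP qv.
  have e0 : frob_dot (vec_mx v) (T0 (vec_mx v)) = 0 by lra.
  have /eqP : frob_norm (T1 (vec_mx v)) ^+ 2 = 0 by lra.
  rewrite sqrf_eq0 => /eqP/frob_norm_eq0 e1.
  have /eqP : frob_norm (T2 (vec_mx v)) ^+ 2 = 0 by lra.
  rewrite sqrf_eq0 => /eqP/frob_norm_eq0 e2.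
  by rewrite -[v]vec_mxK (inj _ e0 e1 e2) linear0.
have [c c0 cP] := posdef_bound ST q0; exists c => // H.
by have := cP (mxvec H); rewrite qE mxvecK frob_dot_mxvec -frob_normE.
Qed.

End PositiveDefinite.

Section Residuals.
Context {R : realType} {m n : nat}.
Implicit Types X Y Z H : 'M[R]_(m, n).

Lemma polar_res_linear Y : linear (polar_res Y).
Proof.
move=> a H K; rewrite /polar_res !mulmxDr -!scalemxAr scalerBr.
by rewrite opprD addrACA.
Qed.

Lemma skew_res_linear Y : linear (skew_res Y).
Proof.
move=> a H K; rewrite /skew_res mulmxDr -!scalemxAr linearD /= linearZ /=.
by rewrite mulmxDl -scalemxAl scalerBr opprD addrACA.
Qed.

Lemma contractive_mulmx_tr k (Y : 'M[R]_(m, n)) (A : 'M[R]_(k, n)) :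
  contractive Y -> frob_norm (A *m Y^T) <= frob_norm A.
Proof.
move=> Yc; rewrite -frob_norm_tr trmx_mul trmxK -(frob_norm_tr A).
exact: contraction_mulmx.
Qed.

Lemma polar_res_perturb Y Z H : contractive Y -> contractive Z ->
  frob_norm (polar_res Y H - polar_res Z H) <= 2 * frob_norm (Y - Z) * frob_norm H.
Proof.
move=> Yc Zc.
have -> : polar_res Y H - polar_res Z H =
    - ((Y *m (Y - Z)^T + (Y - Z) *m Z^T) *m H).
  rewrite /polar_res [(Y - Z)^T]linearB /= mulmxBr mulmxBl addrA subrK mulmxBl.
  rewrite !mulmxA; move: (Y *m Y^T *m H) (Z *m Z^T *m H) => A B.
  by apply/matrixP => i j; rewrite !mxE; ring.
rewrite frob_normN (le_trans (frob_norm_mulmx _ _))// ler_wpM2r ?frob_norm_ge0//.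
rewrite (le_trans (frob_normD _ _))// mulr_natl mulr2n lerD//.
  by rewrite (le_trans (contraction_mulmx _ Yc))// frob_norm_tr.
exact: contractive_mulmx_tr.
Qed.

Lemma skew_res_perturb Y Z H :
  frob_norm (skew_res Y H - skew_res Z H) <= 2 * frob_norm (Y - Z) * frob_norm H.
Proof.
have -> : skew_res Y H - skew_res Z H = (Y - Z)^T *m H - ((Y - Z)^T *m H)^T.
  rewrite /skew_res trmx_mul trmxK [(Y - Z)^T]linearB /= mulmxBl mulmxBr.
  move: (Y^T *m H) (Z^T *m H) (H^T *m Y) (H^T *m Z) => A B C D.
  by apply/matrixP => i j; rewrite !mxE; ring.
rewrite (le_trans (frob_normD _ _))// frob_normN frob_norm_tr -mulrA.
rewrite mulr_natl mulr2n.
by rewrite lerD// (le_trans (frob_norm_mulmx _ _))// frob_norm_tr.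
Qed.

End Residuals.

(** * Quadratic growth of tilted objectives *)

Section Growth.
Context {R : realType} {m n : nat}.
Notation M := 'M[R]_(m, n).
Implicit Types X Y Z H K W V : M.

Lemma lipschitz_continuous (g : M -> R) C :
  (forall X Z, g X - g Z <= C * frob_norm (X - Z)) -> continuous g.
Proof.
move=> gC X; apply/(@cvgrPdist_lt _ _ _ (nbhs X)) => e e0; apply/nbhs_frobP.
have C0 : 0 < `|C| + 1 by rewrite ltr_wpDl.
exists (e / (`|C| + 1)); first exact: divr_gt0.
move=> Z /=; rewrite /frob_ball/= ltr_pdivlMr// => ZX.
have N0 := frob_norm_ge0 (Z - X).
have CN : C * frob_norm (Z - X) <= frob_norm (Z - X) * (`|C| + 1).
  by rewrite mulrC ler_wpM2l// (le_trans (ler_norm C))// lerDl.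
have := gC X Z; have := gC Z X; rewrite (frob_distC X) ltr_norml; lra.
Qed.

(** The quadratic growth of every small tilt around its own minimizer makes
    that minimizer unique, and adding two growth inequalities makes it
    Lipschitz in the tilt. *)
Lemma tilt_stable_of_growth (phi : M -> R) X (gam c : R) (N : set M) :
  0 < gam -> 0 < c -> nbhs (0 : M) N -> is_global_min phi X ->
  (forall V, N V -> exists2 XV, frob_ball X gam XV & forall Z, frob_ball X gam Z ->
    c * frob_norm (Z - XV) ^+ 2 <=
      (phi Z - frob_dot V Z) - (phi XV - frob_dot V XV)) ->
  tilt_stable phi X.
Proof.
move=> gam0 c0 N0 Xmin growth; exists gam; split => //.
pose S V XV := frob_ball X gam XV /\ forall Z, frob_ball X gam Z ->
    c * frob_norm (Z - XV) ^+ 2 <=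
      (phi Z - frob_dot V Z) - (phi XV - frob_dot V XV).
pose g V := get (S V).
have gP V : N V -> S V (g V).
  by move=> /growth[XV XVb XVg]; apply: (@getI _ (S V) XV); split.
exists N, g, c^-1; split => //.
- move=> V /gP[gb gg]; apply/seteqP; split => [Z [Zb Zmin]|_ ->].
    have := gg _ Zb; have /= := Zmin _ gb => h1 h2.
    have : c * frob_norm (Z - g V) ^+ 2 <= 0 by lra.
    rewrite pmulr_rle0// le_eqVlt ltNge sqr_ge0 orbF sqrf_eq0.
    by move=> /eqP/frob_norm_eq0/eqP; rewrite subr_eq0 => /eqP.
  split=> // Z Zb; have := gg _ Zb.
  have := mulr_ge0 (ltW c0) (sqr_ge0 (frob_norm (Z - g V))); lra.
- move=> V W /gP[Vb Vg] /gP[Wb Wg].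
  have := Vg _ Wb; have := Wg _ Vb; rewrite (frob_distC (g W)).
  have := frob_CS (V - W) (g V - g W).
  rewrite !frob_dotBl !frob_dotBr.
  move: (frob_dot _ _) (frob_dot _ _) (frob_dot _ _) (frob_dot _ _) => x1 x2 x3 x4.
  move: (phi _) (phi _) => y1 y2.
  have := frob_norm_ge0 (g V - g W); have := frob_norm_ge0 (V - W).
  move: (frob_norm (V - W)) (frob_norm (g V - g W)) => a b a0 b0 h1 h2 h3.
  rewrite mulrC ler_pdivlMr//.
  have [->|b_n0] := eqVneq b 0; first by rewrite mul0r.
  have b1 : 0 < b by rewrite lt_def b_n0.
  rewrite -(ler_pM2l b1) mulrA -expr2 mulrC.
  have := mulr_ge0 (ltW c0) (sqr_ge0 b); lra.
- have [gb gg] := gP _ (nbhs_singleton N0).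
  have := gg _ (frob_ball_center X gam0); have := Xmin (g 0).
  rewrite !frob_dot0l !subr0 => h1 h2.
  have : c * frob_norm (X - g 0) ^+ 2 <= 0 by lra.
  rewrite pmulr_rle0// le_eqVlt ltNge sqr_ge0 orbF sqrf_eq0.
  by move=> /eqP/frob_norm_eq0/eqP; rewrite subr_eq0 => /eqP.
Qed.

Lemma linear_dist_bound (A B : {linear M -> M}) d H :
  (forall i j, frob_norm (A (delta_mx i j) - B (delta_mx i j)) <= d) ->
  frob_norm (A H - B H) <= m%:R * n%:R * d * frob_norm H.
Proof.
move=> dP.
have -> : A H - B H = \sum_i \sum_j H i j *: (A (delta_mx i j) - B (delta_mx i j)).
  have CE (C : {linear M -> M}) : C H = \sum_i \sum_j H i j *: C (delta_mx i j).
    rewrite {1}(matrix_sum_delta H) linear_sum; apply: eq_bigr => i _.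
    by rewrite linear_sum; apply: eq_bigr => j _; rewrite linearZ.
  rewrite CE (CE B) -sumrB; apply: eq_bigr => i _; rewrite -sumrB.
  by apply: eq_bigr => j _; rewrite scalerBr.
have normS (I : finType) (F : I -> M) : frob_norm (\sum_i F i) <= \sum_i frob_norm (F i).
  elim/big_ind2 : _ => [|? ? ? ? ha hb|//]; first by rewrite frob_norm0.
  exact: le_trans (frob_normD _ _) (lerD ha hb).
apply: (@le_trans _ _ (\sum_(i < m) \sum_(j < n) d * frob_norm H)).
  apply: le_trans (normS _ _) _; apply: ler_sum => i _.
  apply: le_trans (normS _ _) _; apply: ler_sum => j _.
  by rewrite frob_normZ mulrC ler_pM ?frob_norm_ge0 ?frob_norm_entry.
by rewrite !sumr_const !card_ord -[in leLHS]mulr_natl -[in leLHS](mulr_natl _ n) !mulrA.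
Qed.

Lemma quadratic_form_near (A B : {linear M -> M}) d e H :
  (forall i j, frob_norm (B (delta_mx i j) - A (delta_mx i j)) <= d) ->
  m%:R * n%:R * d <= e ->
  frob_dot H (A H) <= frob_dot H (B H) + e * frob_norm H ^+ 2.
Proof.
move=> /(linear_dist_bound H); rewrite frob_distC => AB de; have H0 := frob_norm_ge0 H.
have := frob_CS H (A H - B H); rewrite frob_dotBr => AB'.
rewrite -lerBlDl (le_trans AB')// expr2 mulrCA ler_wpM2l//.
by rewrite (le_trans AB)// ler_wpM2r.
Qed.

Variable f : M -> R.
Hypotheses (C2 : twice_continuously_differentiable f)
  (cf : convex_function (setT : set M) f).

(** The gradient inequalities at [X] and at the midpoint of [X] and [X + D] bound
    the remainder below by an increment of the gradient, to which the mean value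
    theorem applies; this replaces a second-order Taylor formula. *)
Lemma bregman_midpoint X D : exists2 s : R, 0 < s < 1 &
  frob_dot D (hessian f (X + s *: (2^-1 *: D)) D) <=
  4 * (f (X + D) - f X - frob_dot (gradient f X) D).
Proof.
have [s s01 sE] := MVT_gradient_scaled C2 X D D 2^-1; exists s => //.
have := convex_gradient C2 cf (X + 2^-1 *: D) (X + D).
have := convex_gradient C2 cf X (X + 2^-1 *: D).
have -> : X + 2^-1 *: D - X = 2^-1 *: D by rewrite addrC addKr.
have -> : X + D - (X + 2^-1 *: D) = 2^-1 *: D.
  by apply/matrixP => i j; rewrite !mxE; field.
move: sE; move: (frob_dot D (hessian _ _ _)) => h.
move: (f _) (f _) (f _) => y1 y2 y3.
move: (gradient f X) (gradient f (X + 2^-1 *: D)) => G1 G2.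
rewrite !frob_dotZr !(frob_dotC G1) (frob_dotC G2).
move: (frob_dot D G1) (frob_dot D G2) => a b.
lra.
Qed.

(** The Hessian is continuous entry by entry, hence uniformly over the unit
    directions. *)
Lemma hessian_near X (e : R) : 0 < e -> exists2 r : R, 0 < r & forall W, frob_ball X r W ->
  forall H, frob_dot H (hessian f X H) <= frob_dot H (hessian f W H) + e * frob_norm H ^+ 2.
Proof.
move=> e0; have [_ _ hc] := C2.
pose d := e / (1 + m%:R * n%:R).
have d1 : 0 < 1 + m%:R * n%:R :> R by rewrite ltr_pwDl// mulr_ge0.
have d0 : 0 < d by rewrite divr_gt0.
have [r r0 rP] : exists2 r : R, 0 < r & forall W, frob_ball X r W ->
    forall i j, frob_norm (hessian f W (delta_mx i j) - hessian f X (delta_mx i j)) <= d.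
  apply/nbhs_frobP; apply: (@filter_forall _ _ _ (nbhs X)) => i.
  apply: (@filter_forall _ _ _ (nbhs X)) => j; apply/nbhs_frobP.
  have [r r0 rP] := continuous_frob_mxP (hc (delta_mx i j) X) erefl d0.
  by exists r => // W Wr; exact: ltW (rP W Wr).
exists r => // W /rP Wd H.
apply: (@quadratic_form_near (hessian f X) (hessian f W) d e H Wd).
by rewrite /d mulrA ler_pdivrMr// mulrC ler_pM2l// lerDr.
Qed.

End Growth.

(** * From the kernel condition to tilt stability *)

(** Here [c0] is the coercivity constant at the base point and [eta] the size of
    the perturbation of the subgradient.  The latter costs at most a quarter of
    [c0 * D ^+ 2] over the two residuals and the perturbation of the Hessian a
    further quarter, so that half of it remains. *)
Lemma growth_arith (R : realFieldType) (c0 C eta D hX hW F e z a a' b b' : R) :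
  0 < c0 -> 1 <= C -> 0 <= eta -> eta <= 1 -> eta <= c0 / 64 ->
  0 <= F -> 0 <= e -> 0 <= a -> 0 <= b -> z <= C -> 0 <= D ->
  c0 * D ^+ 2 <= hX + a ^+ 2 + b ^+ 2 ->
  a <= a' + 2 * eta * D -> b <= b' + 2 * eta * D ->
  a' ^+ 2 <= 8 * z * e -> b' ^+ 2 <= 8 * z * e ->
  hX <= hW + c0 / 4 * D ^+ 2 -> hW <= 4 * F ->
  c0 / (2 * (4 + 32 * C)) * D ^+ 2 <= F + e.
Proof.
move=> c00 C1 eta0 eta1 etac F0 e0 a0 b0 zC D0 cD aa bb az bz hh hF.
have sq x x' : 0 <= x -> x <= x' + 2 * eta * D -> x' ^+ 2 <= 8 * z * e ->
    x ^+ 2 <= 16 * (C * e) + c0 / 8 * D ^+ 2.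
  move=> x0 xx xz.
  have h1 : x ^+ 2 <= (x' + 2 * eta * D) ^+ 2.
    by rewrite ler_sqr ?nnegrE// (le_trans x0).
  have h2 : (x' + 2 * eta * D) ^+ 2 <= 2 * x' ^+ 2 + 8 * (eta ^+ 2 * D ^+ 2).
    by have := sqr_ge0 (x' - 2 * eta * D); lra.
  have h3 : eta ^+ 2 * D ^+ 2 <= c0 / 64 * D ^+ 2.
    rewrite ler_wpM2r ?sqr_ge0// (le_trans _ etac)// expr2.
    by rewrite ler_piMl.
  have h4 : z * e <= C * e by rewrite ler_wpM2r.
  lra.
have ha := sq _ _ a0 aa az; have hb := sq _ _ b0 bb bz.
have C0 : 0 < 2 * (4 + 32 * C) by lra.
have CF : 0 <= C * F by rewrite mulr_ge0//; lra.
rewrite mulrAC ler_pdivrMr//; lra.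
Qed.

Section Sufficiency.
Context {R : realType} {m n : nat}.
Notation M := 'M[R]_(m, n).
Implicit Types X Y Z H K W V : M.

Variable f : M -> R.
Hypotheses (C2 : twice_continuously_differentiable f)
  (cf : convex_function (setT : set M) f).

Lemma frob_ball_segment X (r s : R) W Z : 0 <= s <= 1 ->
  frob_ball X r W -> frob_ball X r Z -> frob_ball X r (W + s *: (Z - W)).
Proof.
move=> /andP[s0 s1]; rewrite /frob_ball/= => Wr Zr.
have -> : W + s *: (Z - W) - X = (1 - s) *: (W - X) + s *: (Z - X).
  by apply/matrixP => i j; rewrite !mxE; ring.
rewrite (le_lt_trans (frob_normD _ _))// !frob_normZ !ger0_norm ?subr_ge0//.
move: (frob_norm _) (frob_norm _) Wr Zr => a b ar br.
have [->|s_n0] := eqVneq s 0; first by rewrite subr0 mul0r mul1r addr0.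
have s2 : 0 < s by rewrite lt_def s_n0.
nra.
Qed.

(** Fermat's rule at a minimizer over a ball: by convexity of the nuclear norm
    only the linear part of [f] matters along a short segment. *)
Lemma subdiff_of_local_min X V (r : R) : 0 < r ->
  (forall Z, frob_ball X r Z -> f X + nuclear_norm X - frob_dot V X <=
     f Z + nuclear_norm Z - frob_dot V Z) ->
  subdiff nuclear_norm X (V - gradient f X).
Proof.
move=> r0 Xmin Z; set D := Z - X.
suff : frob_dot (- D) (gradient f X) <= nuclear_norm Z - nuclear_norm X - frob_dot V D.
  rewrite frob_dotNl (frob_dotC D); move: (gradient f X) => G.
  rewrite frob_dotBl; move: (frob_dot G D) (frob_dot V D) => a b.
  by move: (nuclear_norm X) (nuclear_norm Z) => x z; lra.
apply: (@le_closure _ _ _ (fun W => frob_dot (- D) (gradient f W))).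
  exact: continuous_dot_gradient.
move=> e e0; have er0 : 0 < Num.min e r by rewrite lt_min e0 r0.
have [t /andP[t0 t1] tr] := small_step (m := m) (n := n) (frob_norm_ge0 D) er0.
have [s /andP[s0 s1] sE] := MVT_fun C2 X (t *: D).
have {}tr s' : 0 <= s' <= 1 -> frob_ball X e (X + s' *: (t *: D)) /\
    frob_ball X r (X + s' *: (t *: D)).
  move=> s01; have := tr X D s' (lexx _) s01.
  by rewrite /frob_ball/= lt_min => /andP[].
exists (X + s *: (t *: D)); first by have [] := tr s _; rewrite ?(ltW s0) ?(ltW s1).
have [_] : frob_ball X e (X + 1 *: (t *: D)) /\ frob_ball X r (X + 1 *: (t *: D)).
  by apply: tr; rewrite ler01 lexx.
rewrite scale1r => /Xmin; move: sE; move: (gradient f _) => G.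
have := @nuclear_norm_conv R m n X Z t; rewrite (ltW t0) (ltW t1) => /(_ isT).
rewrite -/D frob_dotDr !frob_dotZr frob_dotNl (frob_dotC D).
move: (f X) (f _) (nuclear_norm X) (nuclear_norm Z) (nuclear_norm _) => y1 y2 x1 x2 x3.
move: (frob_dot G D) (frob_dot V D) (frob_dot V X) => a b c h1 h2 h3.
rewrite -(ler_pM2l t0); lra.
Qed.

Variables X Y : M.
Hypotheses (Yc : contractive Y) (XY : defect Y X = 0) (YE : Y = - gradient f X).

Lemma residuals_of_subgradient Z W : contractive Z -> defect Z W = 0 ->
  polar_res Z W = 0 /\ skew_res Z W = 0.
Proof.
move=> Zc ZW; have := polar_res_defect W Zc; have := skew_res_defect W Zc.
rewrite ZW mulr0 => h1 h2; split; apply: frob_norm_eq0; apply/eqP.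
  by rewrite -sqrf_eq0 eq_le h2 sqr_ge0.
by rewrite -sqrf_eq0 eq_le h1 sqr_ge0.
Qed.

Hypothesis inj : forall H, hessian f X H = 0 -> polar_res Y H = 0 ->
  skew_res Y H = 0 -> H = 0.

(** The residuals of [K] vanish at [W], so their values at [Z - W] are those at
    [Z], which the defect of [K] at [Z] controls.  The resulting lower bound is
    compared with the coercive quadratic form at [X] and [Y]. *)
Lemma uniform_growth : exists2 gam : R, 0 < gam & exists2 c : R, 0 < c &
  forall W Z K, frob_ball X gam W -> frob_ball X gam Z ->
    contractive K -> frob_norm (K - Y) < gam -> defect K W = 0 ->
    c * frob_norm (Z - W) ^+ 2 <=
      f Z - f W - frob_dot (gradient f W) (Z - W) + defect K Z.
Proof.
pose T1 : {linear M -> M} := HB.pack (polar_res Y : M -> M)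
  (GRing.isLinear.Build _ _ _ _ _ (polar_res_linear Y)).
pose T2 : {linear M -> 'M[R]_n} := HB.pack (skew_res Y : M -> 'M[R]_n)
  (GRing.isLinear.Build _ _ _ _ _ (skew_res_linear Y)).
have [c0 c00 c0P] : exists2 c : R, 0 < c & forall H, c * frob_norm H ^+ 2 <=
    frob_dot H (hessian f X H) + frob_norm (polar_res Y H) ^+ 2 +
    frob_norm (skew_res Y H) ^+ 2.
  apply: (@coercive _ _ _ _ _ _ _ (hessian f X) T1 T2).
    by move=> H; exact: hessian_psd.
  by move=> H /(hessian_ker_of_dot0 C2 cf) h0 h1 h2; exact: inj.
have c04 : 0 < c0 / 4 by lra.
have [r r0 hr] := hessian_near C2 X c04.
pose eta := Num.min 1 (c0 / 64).
have eta0 : 0 < eta by rewrite lt_min ltr01/=; lra.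
pose gam := Num.min 1 (Num.min r eta).
pose C := frob_norm X + 1.
have C0 : 1 <= C by rewrite lerDr frob_norm_ge0.
exists gam; first by rewrite lt_min ltr01 lt_min r0 eta0.
exists (c0 / (2 * (4 + 32 * C))); first by rewrite divr_gt0//; lra.
move=> W Z K Wg Zg Kc; rewrite !lt_min => /and4P[_ _ K1 K2] KW.
set D := Z - W.
have ZC : frob_norm Z <= C.
  have := Zg; rewrite /frob_ball/= !lt_min => /andP[Z1 _].
  have -> : Z = X + (Z - X) by rewrite addrCA subrr addr0.
  by rewrite (le_trans (frob_normD _ _))// lerD2l ltW.
have [pW sW] := residuals_of_subgradient Kc KW.
have WD : Z = 1 *: D + W by rewrite scale1r /D subrK.
have pD : polar_res K Z = polar_res K D.
  by rewrite WD polar_res_linear pW addr0 scale1r.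
have sD : skew_res K Z = skew_res K D.
  by rewrite WD skew_res_linear sW addr0 scale1r.
have e0 := defect_ge0 Z Kc.
have p2 := polar_res_defect Z Kc; have s2 := skew_res_defect Z Kc.
rewrite pD in p2; rewrite sD in s2.
have pt := frob_normD (polar_res K D) (polar_res Y D - polar_res K D).
have st := frob_normD (skew_res K D) (skew_res Y D - skew_res K D).
rewrite addrC subrK in pt; rewrite addrC subrK in st.
have [s s01 sP] := bregman_midpoint C2 cf W D.
have hrW : frob_ball X r (W + s *: (2^-1 *: D)).
  have : frob_ball X gam (W + (s * 2^-1) *: D).
    apply: frob_ball_segment => //; case/andP: s01 => s0 s1; lra.
  by rewrite scalerA /frob_ball/= !lt_min => /and3P[].
have F0 : 0 <= f Z - f W - frob_dot (gradient f W) D.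
  have := convex_gradient C2 cf W Z; rewrite -/D.
  by move: (f Z) (f W) (frob_dot _ D) => x y z; lra.
have ZE : W + D = Z by rewrite /D addrC subrK.
rewrite ZE in sP.
have KY : frob_norm (Y - K) <= eta by rewrite frob_distC le_min (ltW K1) (ltW K2).
have eta1 : eta <= 1 by rewrite ge_min lexx.
have etac : eta <= c0 / 64 by rewrite ge_min lexx orbT.
have le2 (x : R) : x <= 2 * frob_norm (Y - K) * frob_norm D ->
    x <= 2 * eta * frob_norm D.
  by move=> /le_trans; apply; rewrite ler_wpM2r ?frob_norm_ge0// ler_wpM2l.
apply: (growth_arith c00 C0 (ltW eta0) eta1 etac F0 e0 (frob_norm_ge0 _)
  (frob_norm_ge0 _) ZC (frob_norm_ge0 D) (c0P D) _ _ p2 s2 (hr _ hrW D) sP).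
  apply: le_trans pt _; rewrite lerD2l; exact/le2/polar_res_perturb.
apply: le_trans st _; rewrite lerD2l; exact/le2/skew_res_perturb.
Qed.

Hypothesis Xmin : is_global_min (fun Z => f Z + nuclear_norm Z) X.

(** A minimizer over a compact ball exists; growth at [X] places it inside the
    ball as soon as the tilt is small, so that it comes with a subgradient, and
    the uniform growth applies at the minimizer itself. *)
Theorem tilt_stable_of_kernel : tilt_stable (fun Z => f Z + nuclear_norm Z) X.
Proof.
have [gam gam0 [c c0 growth]] := uniform_growth.
have gam2 : 0 < gam / 2 by lra.
have [rho rho0 rhoP] := continuous_frob_mxP (@continuous_gradient _ _ _ _ C2 X) erefl gam2.
pose d := Num.min (gam / 2) rho.
have d0 : 0 < d by rewrite lt_min gam2.
pose tau := Num.min (gam / 2) (c * d).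
have tau0 : 0 < tau by rewrite lt_min gam2 mulr_gt0.
apply: (@tilt_stable_of_growth _ _ _ _ X gam c (frob_ball 0 tau)) => //.
  by apply/nbhs_frobP; exists tau.
move=> V; rewrite /frob_ball/= subr0 !lt_min => /andP[V1 V2].
pose Psi Z := f Z + nuclear_norm Z - frob_dot V Z.
pose A := [set Z | frob_norm (Z - X) <= gam / 2].
have [XV] : exists2 XV, XV \in A & forall Z, Z \in A -> Psi XV <= Psi Z.
  apply: compact_EVT_min.
  - by exists X; rewrite /A/= subrr frob_norm0 ltW.
  - apply: (@compact_frob_bounded _ _ _ _ (frob_norm X + gam / 2)) => [|Z].
      have nc : continuous (fun Z : M => frob_norm (Z - X)).
        apply: (@lipschitz_continuous _ _ _ _ 1) => Z W.
        rewrite mul1r lerBlDr.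
        by have := frob_norm_tri Z W X.
      exact: (preimage_closed (fun Z _ => nc Z) (@closed_le _ (gam / 2))).
    rewrite /A/= => ZX; have -> : Z = X + (Z - X) by rewrite addrCA subrr addr0.
    by rewrite (le_trans (frob_normD _ _))// lerD2l.
  - have cP : continuous ((f : M -> R^o) + nuclear_norm - frob_dot V : M -> R^o).
      move=> Z; apply: continuousB; last exact: continuous_frob_dot.
      apply: continuousD; first exact: (continuous_fun C2).
      exact: (lipschitz_continuous nuclear_norm_lipschitz).
    exact: (continuous_subspaceT cP).
rewrite inE => XVA XVmin.
have grow0 Z : frob_ball X gam Z -> c * frob_norm (Z - X) ^+ 2 <=
    f Z + nuclear_norm Z - (f X + nuclear_norm X).
  move=> Zg; have gX := frob_ball_center X gam0.
  have YY : frob_norm (Y - Y) < gam by rewrite subrr frob_norm0.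
  apply: le_trans (growth _ _ _ gX Zg Yc YY XY) _.
  have -> : frob_dot (gradient f X) (Z - X) = - frob_dot Y (Z - X).
    by rewrite YE frob_dotNl opprK.
  move/eqP: XY; rewrite /defect subr_eq0 frob_dotBr => /eqP ->.
  move: (f X) (f Z) (nuclear_norm Z) => x z w.
  by move: (frob_dot Y Z) (frob_dot Y X) => a b; lra.
have XVg : frob_ball X gam XV by rewrite /frob_ball/= (le_lt_trans XVA)//; lra.
have XVd : frob_norm (XV - X) < d.
  have h1 : c * frob_norm (XV - X) ^+ 2 <= frob_norm V * frob_norm (XV - X).
    apply: le_trans (grow0 _ XVg) _; apply: le_trans (frob_CS V (XV - X)).
    have : Psi XV <= Psi X by apply: XVmin; rewrite inE /A/= subrr frob_norm0 ltW.
    rewrite /Psi frob_dotBr; move: (f X) (f XV) (nuclear_norm X) => x y z.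
    by move: (nuclear_norm XV) (frob_dot V XV) (frob_dot V X) => w a b; lra.
  have [->//|XV0] := eqVneq (frob_norm (XV - X)) 0.
  have XV1 : 0 < frob_norm (XV - X) by rewrite lt_def XV0 frob_norm_ge0.
  move: h1; rewrite expr2 mulrA ler_pM2r// => h1.
  by rewrite -(ltr_pM2l c0); exact: le_lt_trans h1 V2.
have XVsub : subdiff nuclear_norm XV (V - gradient f XV).
  have rr : 0 < gam / 2 - frob_norm (XV - X).
    by move: XVd; rewrite lt_min subr_gt0 => /andP[].
  apply: (subdiff_of_local_min rr) => Z Zr; apply: XVmin; rewrite inE.
  move: Zr; rewrite /frob_ball/A/= => Zr.
  by rewrite (le_trans (frob_norm_tri _ XV _))// -lerBrDr ltW.
have [Kc KX] := (subdiff_nuclear_normP _ _).1 XVsub.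
exists XV => // Z Zg.
have KY : frob_norm (V - gradient f XV - Y) < gam.
  have /rhoP : frob_ball X rho XV.
    by move: XVd; rewrite /frob_ball/= lt_min => /andP[].
  rewrite YE; move: (gradient f XV) (gradient f X) => G1 G2 G12.
  have -> : V - G1 - - G2 = V - (G1 - G2) by rewrite opprK opprB addrA addrAC.
  rewrite (le_lt_trans (frob_normD _ _))// frob_normN; lra.
have := growth _ _ _ XVg Zg Kc KY KX; move: KX.
move: (gradient f XV) => G /eqP; rewrite /defect subr_eq0 => /eqP ->.
rewrite frob_dotBr !frob_dotBl => /le_trans; apply.
move: (f XV) (f Z) (nuclear_norm Z) => x z w.
move: (frob_dot G Z) (frob_dot G XV) (frob_dot V Z) (frob_dot V XV) => a1 a2 a3 a4.
lra.
Qed.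

End Sufficiency.

(** * The characterization *)

Theorem theorem4p6 (R : realType) (n1 n2 : nat) (hn : (n1 <= n2)%N)
    (f : 'M[R]_(n1, n2) -> R)
    (hC2 : twice_continuously_differentiable f)
    (hconv : @convex_function R 'M[R]_(n1, n2) setT f)
    (Xb Yb : 'M[R]_(n1, n2))
    (hopt : is_global_min (fun X => f X + nuclear_norm X) Xb)
    (hYb : Yb = - gradient f Xb)
    (hsub : subdiff nuclear_norm Xb Yb)
    (U : 'M[R]_n1) (V : 'M[R]_n2)
    (hUV : (ordered_svd Xb `&` ordered_svd Yb) (U, V)) :
  tilt_stable (fun X => f X + nuclear_norm X) Xb <->
  hessian_ker f Xb `&` sym_block_space (num_unit_sing_vals Yb) U V
    = [set 0].
Proof.
have [[/= U1 V1 XE] [/= _ _ YE]] := hUV.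
have [Yc XY] := (subdiff_nuclear_normP Xb Yb).1 hsub.
set p := num_unit_sing_vals Yb.
pose P : 'M[R]_(n1, p) := frameL U Yb; pose Q : 'M[R]_(n2, p) := frameR V Yb.
have P1 : P^T *m P = 1%:M by exact: frameL_orth.
have Q1 : Q^T *m Q = 1%:M by exact: frameR_orth.
have YQ : Yb *m Q = P.
  exact: (mulmx_frameR hn U1 V1 YE Yc).
have YP : Yb^T *m P = Q.
  exact: (mulmx_frameL hn U1 V1 YE Yc).
have [B BE [BT B0]] := frame_base hn U1 V1 YE XE Yc XY.
have blockE : sym_block_space p U V = [set P *m A *m Q^T | A in [set A : 'M[R]_p | A^T = A]].
  apply/seteqP; split=> [_ [A AT <-]|_ [A AT <-]]; exists A => //;
  by rewrite frame_block.
rewrite blockE; split=> [tilt|ker0].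
  apply/seteqP; split=> [H [hH [A AT HE]]|_ ->]; last first.
    split; first by rewrite /hessian_ker/= linear0.
    by exists 0; rewrite /= ?trmx0// mulmx0 mul0mx.
  rewrite -HE in hH; rewrite -HE /=.
  exact: (tilt_stable_kernel hC2 hconv P1 Q1 YQ Yc BE BT B0 AT hYb tilt hH).
apply: (tilt_stable_of_kernel hC2 hconv Yc XY hYb _ hopt) => H hH pH sH.
have HE : H = Yb *m (Yb^T *m H) by move/eqP: pH; rewrite subr_eq0 => /eqP.
have [A AT HA] := sym_block_of_residuals P1 Q1 YP (frame_proj hn U1 V1 YE Yc HE) pH sH.
have : [set (0 : 'M[R]_(n1, n2))] H by rewrite -ker0; split => //; exists A.
by [].
Qed.
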